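(* Let $k\geq 3$ and let $H$ be a $k$-graph. Then there exists an integer $n_0=n_0(H)$ such that for all $n\geq n_0$ with $n\equiv 1\pmod{k-1}$, $$R(P^{(k)}_{n,1},H)\leq (\chi(H)-1)(n-1)+\max\{\tau(k-1,\sigma(H))-2k+3,\ \sigma(H)\}.$$
   Context: A $k$-graph is a $k$-uniform hypergraph. $R(G,H)$ is the least $N$ such that every red/blue colouring of the edges of $K^{(k)}_N$ contains a red copy of $G$ or a blue copy of $H$. A proper colouring is a vertex colouring with no monochromatic edge; $\chi(H)$ is the least number of colours of a proper colouring, and $\sigma(H)$ is the smallest possible size of a colour class in a proper colouring of $H$ with $\chi(H)$ colours. The loose path $P^{(k)}_{n,1}$ ($n=q(k-1)+1$) has vertices $v_1,\dots,v_n$ and edges $\{v_{(i-1)(k-1)+1},\dots,v_{i(k-1)+1}\}$, $i\in[q]$. For integers $j,\alpha\ge1$, $\tau(j,\alpha)$ is the largest $N$ such that some $j$-uniform hypergraph on $N$ vertices has independence number less than $\alpha$ and no two edges meeting in exactly one vertex. *)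

(* Defs.v *)
From mathcomp Require Import all_boot all_order.
From Stdlib Require Import ClassicalEpsilon.
Set Implicit Arguments. Unset Strict Implicit. Unset Printing Implicit Defensive.

Definition uniform (V : finType) (k : nat) (E : {set {set V}}) : Prop :=
  forall e, e \in E -> #|e| = k.

(* A red/blue colouring of the edges of K^(k)_N : vertices 'I_N, colour
   true = red, false = blue (only values on k-sets are relevant). *)
Definition has_copy (V : finType) (E : {set {set V}}) (N : nat)
    (c : {set 'I_N} -> bool) (col : bool) : Prop :=
  exists f : V -> 'I_N, injective f /\ forall e, e \in E -> c (f @: e) = col.

Definition arrows (k : nat) (VG : finType) (G : {set {set VG}})
    (VH : finType) (H : {set {set VH}}) (N : nat) : Prop :=
  forall c : {set 'I_N} -> bool,
    (forall S : {set 'I_N}, #|S| != k -> c S = true) -> (* colour only k-sets; irrelevant on others *)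
    has_copy G c true \/ has_copy H c false.

Definition ramsey (k : nat) (VG : finType) (G : {set {set VG}})
    (VH : finType) (H : {set {set VH}}) : nat :=
  epsilon (inhabits 0%N)
    (fun N => arrows k G H N /\ forall M, (M < N)%N -> ~ arrows k G H M).

Definition proper (V : finType) (E : {set {set V}}) (c : nat) (f : V -> 'I_c) : bool :=
  [forall e in E, [exists x in e, exists y in e, f x != f y]].

Definition colourable (V : finType) (E : {set {set V}}) (c : nat) : bool :=
  [exists f : {ffun V -> 'I_c}, proper E f].

(* chi(H): least number of colours of a proper colouring (searched among
   0..|V|; a k-graph with k >= 2 is always |V|-colourable). *)
Definition chi (V : finType) (E : {set {set V}}) : nat :=
  find (colourable E) (iota 0 #|V|.+1).

Definition sigma (V : finType) (E : {set {set V}}) : nat :=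
  \big[minn/#|V|]_(f : {ffun V -> 'I_(chi E)} | proper E f)
     \big[minn/#|V|]_(i : 'I_(chi E)) #|[set v | f v == i]|.

(* vertices v_1..v_n are 'I_n (v_{m+1} is m); with q = (n-1)/(k-1), edge i
   (i = 1..q) is {v_{(i-1)(k-1)+1}, ..., v_{i(k-1)+1}}. *)
Definition loose_path (k n : nat) : {set {set 'I_n}} :=
  [set [set v : 'I_n | (i * k.-1 <= v <= i * k.-1 + k.-1)%N]
     | i : 'I_((n.-1) %/ k.-1)].

Definition indep_num (V : finType) (E : {set {set V}}) : nat :=
  \max_(S : {set V} | [forall e in E, ~~ (e \subset S)]) #|S|.

Definition no_one_intersection (V : finType) (E : {set {set V}}) : Prop :=
  forall e f, e \in E -> f \in E -> #|e :&: f| != 1%N.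

Definition tau_good (j alpha N : nat) : Prop :=
  exists E : {set {set 'I_N}},
    uniform j E /\ (indep_num E < alpha)%N /\ no_one_intersection E.

Definition tau (j alpha : nat) : nat :=
  epsilon (inhabits 0%N)
    (fun N => tau_good j alpha N /\ forall M, (N < M)%N -> ~ tau_good j alpha M).

(* Main.v *)
(** Let r = chi(H) - 1, N = r (n - 1) + max(tau - 2k + 3, sigma), and suppose that a colouring of
    K_N has neither a red path on n vertices nor a blue H. By Ramsey's theorem every large set
    contains a large red clique, and chi(H) disjoint sets that are not too small always span a
    red edge meeting two of them, for otherwise there is a blue H.

    Choose greedily r closed necklaces of red cliques, each one as long as possible outside the
    previous ones. If many vertices were left over, they would contain a red clique, and a pair
    of red edges linking it, or the last clique of a necklace, to the last clique of an earlier
    necklace would lengthen the latter. So only boundedly many vertices are left; as each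
    necklace carries fewer than n of them, each has nearly n vertices, and no red edge joins two
    necklaces. A red edge with between 1 and k-2 vertices in the rest and the others in a clique
    of a necklace lets the necklace absorb its outside vertices, and so do two such edges with
    k-1 vertices outside, meeting there in a single vertex. By definition of tau one of these
    exists while the rest has more than tau vertices. Afterwards a red edge with k-1 vertices
    outside is used as an end of the red path, which may happen twice.

    A necklace with at most n - 1 vertices leaves a rest of size at least
    max(tau - 2k + 3, sigma), because opening it loses at most k - 2 vertices and the order of a
    loose path is 1 modulo k - 1. Since the rest always has at least sigma vertices the process
    never stops; but two ends bring it down from tau to tau - 2 (k - 1). *)

From mathcomp Require Import all_boot all_order zify.
From Stdlib Require Import Classical ClassicalEpsilon.
Require Import Defs.
Set Implicit Arguments. Unset Strict Implicit. Unset Printing Implicit Defensive.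

(** * Subsets of prescribed size and cardinality estimates *)

Lemma subset_between (T : finType) (A B : {set T}) m :
  A \subset B -> #|A| <= m -> m <= #|B| ->
  exists C : {set T}, [/\ A \subset C, C \subset B & #|C| = m].
Proof.
move=> sAB hA; elim: m hA => [|m IH] hA hB.
  by exists A; split=> //; lia.
case: (ltnP m #|A|) => [lt|le].
  by exists A; split=> //; lia.
have [C [sAC sCB cC]] := IH le (ltnW hB).
have : 0 < #|B :\: C| by rewrite cardsD (setIidPr sCB); lia.
case/card_gt0P=> x; rewrite inE => /andP[xC xB].
exists (x |: C); split.
- by apply: subset_trans sAC (subsetUr _ _).
- by rewrite subUset sub1set xB.
- by rewrite cardsU1 xC cC.
Qed.

Lemma subset_card2 (T : finType) (B : {set T}) a b m :
  a \in B -> b \in B -> 2 <= m <= #|B| ->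
  exists C : {set T}, [/\ a \in C, b \in C, {subset C <= B} & #|C| = m].
Proof.
move=> aB bB /andP[h2 hm].
have [||C [sC CB cC]] := @subset_between T [set a; b] B m _ _ hm.
- by rewrite subUset !sub1set aB.
- by apply: leq_trans h2; rewrite cards2; case: (a != b).
exists C; split=> //; last by apply/subsetP.
- by apply: (subsetP sC); rewrite !inE eqxx.
- by apply: (subsetP sC); rewrite !inE eqxx orbT.
Qed.

Lemma card_setD_ge (T : finType) (A B : {set T}) : #|A| <= #|A :\: B| + #|B|.
Proof. by rewrite -(cardsID B A); have := subset_leq_card (subsetIr A B); lia. Qed.

Lemma card_setU_le (T : finType) (A B : {set T}) : #|A :|: B| <= #|A| + #|B|.
Proof. by case: (leq_card_setU A B). Qed.

Definition meet_at (T : finType) (A B : {set T}) (b : T) : Prop :=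
  forall z, z \in A -> z \in B -> z = b.

Lemma meet_atC (T : finType) (A B : {set T}) b : meet_at A B b -> meet_at B A b.
Proof. by move=> h z zB zA; apply: h. Qed.

(** * Red loose paths *)

Section Paths.

Variables (T : finType) (k : nat) (red : {set T} -> bool).
Hypothesis hk : 3 <= k.
Implicit Types (A B D E G S Q e f g : {set T}) (a b x y z : T).

Definition red_edge e : Prop := #|e| = k /\ red e.

Definition clique D : Prop := forall e, e \subset D -> #|e| = k -> red e.

Lemma clique_sub D E : clique D -> {subset E <= D} -> clique E.
Proof.
by move=> cD sED e se; apply: cD; apply: subset_trans se _; apply/subsetP.
Qed.

(** A path is known only by its ends and its vertex set, which suffices for gluing and counting; an
    ordering is recovered in [rpath_seq]. *)
Inductive rpath : T -> T -> {set T} -> Prop :=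
| rpath0 a : rpath a a [set a]
| rpathS a b c e S : red_edge e -> a \in e -> b \in e -> a != b ->
    rpath b c S -> meet_at e S b -> rpath a c (e :|: S).

Lemma rpath_l a b S : rpath a b S -> a \in S.
Proof. by case=> [x|x y z e S' _ xe *]; rewrite !inE ?eqxx // xe. Qed.

Lemma rpath_r a b S : rpath a b S -> b \in S.
Proof.
by elim=> [x|x y z e S' _ _ _ _ _ h _]; rewrite !inE ?eqxx // h orbT.
Qed.

Lemma rpath_edge a b e : red_edge e -> a \in e -> b \in e -> a != b -> rpath a b e.
Proof.
move=> he ae be ab.
rewrite -[e](_ : e :|: [set b] = e); last by apply/setUidPl; rewrite sub1set.
by apply: rpathS (rpath0 b) _ => // z _; rewrite inE => /eqP.
Qed.

Lemma rpath_cat a b c S S' :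
  rpath a b S -> rpath b c S' -> meet_at S S' b -> rpath a c (S :|: S').
Proof.
elim=> {a b S} [a|a b d e S he ae be ab hS IH hm] hS' hmm.
  by rewrite (setUidPr _) // sub1set (rpath_l hS').
rewrite -setUA; apply: rpathS he ae be ab _ _.
  by apply: IH => // z zS; apply: hmm; rewrite inE zS orbT.
move=> z ze; rewrite inE => /orP[zS|zS']; first exact: hm.
have zd : z = d by apply: hmm => //; rewrite inE ze.
by apply: hm => //; rewrite zd (rpath_r hS).
Qed.

Lemma rpath_rev a b S : rpath a b S -> rpath b a S.
Proof.
elim=> {a b S} [a|a b d e S he ae be ab hS IH hm]; first exact: rpath0.
rewrite setUC; apply: (rpath_cat IH).
  by apply: rpath_edge => //; rewrite eq_sym.
exact: meet_atC.
Qed.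

(** Each edge contributes $k-1$ vertices beyond its joint. This congruence later pays for losses of
    $k-2$ vertices. *)
Lemma rpath_card a b S : rpath a b S -> exists q, #|S| = q * k.-1 + 1.
Proof.
elim=> {a b S} [a|a b d e S [he _] ae be ab hS [q IH] hm].
  by exists 0; rewrite cards1.
exists q.+1; rewrite cardsU IH he.
have -> : e :&: S = [set b].
  apply/setP=> z; rewrite !inE; apply/andP/eqP => [[ze zS]|->]; first exact: hm.
  by split=> //; apply: rpath_l hS.
by rewrite cards1; lia.
Qed.

Lemma clique_edge D e : clique D -> {subset e <= D} -> #|e| = k -> red_edge e.
Proof. by move=> cD se ke; split=> //; apply: cD => //; apply/subsetP. Qed.

(** Peel off an edge through [a] and a new vertex [c] that avoids [b]: what remains, with [c] put
    back, is a clique of the next smaller admissible order. *)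
Lemma rpath_clique q D a b : clique D -> #|D| = q.+1 * k.-1 + 1 ->
  a \in D -> b \in D -> a != b -> rpath a b D.
Proof.
elim: q D a => [|q IH] D a cD hD aD bD ab.
  by apply: rpath_edge => //; apply: clique_edge cD _ _ => //; lia.
have [c] : exists c, c \in D :\: [set a; b].
  by apply/card_gt0P; have := card_setD_ge D [set a; b]; rewrite cards2 ab hD; nia.
rewrite !inE negb_or => /andP[/andP[ca cb] cD'].
have [|||e [ae ce se cde]] := @subset_card2 T (D :\ b) a c k _ _ _.
- by rewrite !inE ab.
- by rewrite !inE cb.
- by move: (cardsD1 b D); rewrite bD hD; nia.
have sD z : z \in e -> z \in D by move/se; rewrite !inE => /andP[].
have bne : b \notin e by apply/negP=> /se; rewrite !inE eqxx.
rewrite [D](_ : D = e :|: (c |: (D :\: e))); last first.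
  apply/setP=> z; rewrite !inE; case ze: (z \in e) => //=; first exact: sD.
  by case: eqP => [->|].
apply: (rpathS (b := c)) => //; first exact: clique_edge cD sD cde.
- by rewrite eq_sym.
- apply: IH.
  + apply: clique_sub cD _ => z; rewrite !inE => /orP[/eqP->//|/andP[] //].
  + rewrite cardsU1 !inE ce /= cardsD (setIidPr _); first by rewrite hD; nia.
    by apply/subsetP.
  + by rewrite !inE eqxx.
  + by rewrite !inE bne bD orbT.
  + by [].
- by move=> z ze; rewrite !inE ze /= orbF => /eqP.
Qed.

Lemma rpath_in_clique D a b : clique D -> k <= #|D| ->
  a \in D -> b \in D -> a != b ->
  exists D0, [/\ rpath a b D0, {subset D0 <= D} & #|D| <= #|D0| + (k - 2)].
Proof.
move=> cD hD aD bD ab.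
pose q := (#|D| - k) %/ k.-1.
have hq : q * k.-1 <= #|D| - k < q.+1 * k.-1.
  by rewrite leq_divM /= -ltn_divLR //; lia.
have [|D0 [aD0 bD0 sD0 cD0]] := @subset_card2 T D a b (q.+1 * k.-1 + 1) aD bD.
  by nia.
exists D0; split=> //; last by rewrite cD0; nia.
by apply: (@rpath_clique q) => //; apply: clique_sub cD _.
Qed.

Lemma edge_in_clique D a b : clique D -> k <= #|D| ->
  a \in D -> b \in D ->
  exists E, [/\ red_edge E, a \in E, b \in E & {subset E <= D}].
Proof.
move=> cD hD aD bD.
have [|E [aE bE sE cE]] := @subset_card2 T D a b k aD bD; first by lia.
by exists E; split=> //; apply: clique_edge cD _ _.
Qed.

(* [slotted l p a b S] is a red path on [S] from [a] to [b] that crosses [p] pairwise disjoint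
   red cliques of size [l], using all the vertices of each of them. *)
Inductive slotted (l : nat) : nat -> T -> T -> {set T} -> Prop :=
| slotted0 a b S : rpath a b S -> slotted l 0 a b S
| slottedS p a a' b' c S1 D S2 : rpath a a' S1 -> clique D -> #|D| = l ->
    a' \in D -> b' \in D -> a' != b' -> slotted l p b' c S2 ->
    meet_at S1 D a' -> meet_at D S2 b' -> (forall z, z \in S1 -> z \notin S2) ->
    slotted l p.+1 a c (S1 :|: D :|: S2).

Lemma slotted_inv l p a c S : slotted l p.+1 a c S -> exists a' b' S1 D S2,
  [/\ S = S1 :|: D :|: S2, clique D, #|D| = l & [/\ a' \in D, b' \in D & a' != b']] /\
  [/\ rpath a a' S1, slotted l p b' c S2, meet_at S1 D a', meet_at D S2 b' &
    forall z, z \in S1 -> z \notin S2].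
Proof.
move E: p.+1 => p' h.
case: h E => // {p'} p' a1 a' b' c1 S1 D S2 h1 cD hD aD bD ab h2 m1 m2 dis [->].
by exists a', b', S1, D, S2.
Qed.

Variables (l q0 : nat).
Hypothesis hl : l = q0.+1 * k.-1 + 1.

(** The order [l] of a slot is $1$ modulo $k-1$, so [rpath_clique] crosses it through all its
    vertices. *)
Lemma slotted_rpath p a b S : slotted l p a b S -> rpath a b S.
Proof.
elim=> {p a b S} // p a a' b' c S1 D S2 h1 cD hD aD bD ab _ IH m1 m2 dis.
apply: rpath_cat IH _.
  by apply: rpath_cat h1 _ m1; apply: (@rpath_clique q0) => //; rewrite hD.
move=> z; rewrite inE => /orP[zS1|zD]; last exact: m2.
by move=> zS2; have := dis _ zS1; rewrite zS2.
Qed.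

Lemma slotted_cat p a b c S Q : slotted l p a b S -> rpath b c Q ->
  meet_at S Q b -> slotted l p a c (S :|: Q).
Proof.
elim=> {p a b S} [a b S hS|p a a' b' d S1 D S2 h1 cD hD aD bD ab hS2 IH m1 m2 dis] hQ hm.
  by apply: slotted0; apply: rpath_cat hS hQ hm.
rewrite -setUA; apply: slottedS h1 cD hD aD bD ab _ m1 _ _.
- by apply: IH => // z zS2; apply: hm; rewrite inE zS2 orbT.
- move=> z zD; rewrite inE => /orP[|zQ]; first exact: m2.
  have zd : z = d by apply: hm => //; rewrite !inE zD orbT.
  by apply: m2 => //; rewrite zd (rpath_r (slotted_rpath hS2)).
- move=> z zS1; rewrite inE negb_or dis //=; apply/negP=> zQ.
  have zd : z = d by apply: hm => //; rewrite !inE zS1.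
  by have := dis _ zS1; rewrite zd (rpath_r (slotted_rpath hS2)).
Qed.

Lemma slotted_pre p z a b Q S : rpath z a Q -> slotted l p a b S ->
  meet_at Q S a -> slotted l p z b (Q :|: S).
Proof.
move=> hQ hS; case: hS hQ => {p a b S} [a b S hS|p a a' b' d S1 D S2 h1 cD hD aD bD ab hS2 m1 m2 dis] hQ hm.
  by apply: slotted0; apply: rpath_cat hQ hS hm.
have key w : w \in Q -> w \in D :|: S2 -> w = a.
  by move=> wQ; rewrite inE => h; apply: hm => //; rewrite !inE -orbA h orbT.
rewrite 2!setUA; apply: slottedS _ cD hD aD bD ab hS2 _ m2 _.
- by apply: rpath_cat hQ h1 _ => w wQ wS; apply: hm => //; rewrite !inE wS.
- move=> w; rewrite inE => /orP[wQ|wS1] wD; last exact: m1.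
  have wa : w = a by apply: key => //; rewrite inE wD.
  by apply: m1 => //; rewrite wa (rpath_l h1).
- move=> w; rewrite inE => /orP[wQ|]; last exact: dis.
  apply/negP=> wS2; have wa : w = a by apply: key => //; rewrite inE wS2 orbT.
  by have := dis a (rpath_l h1); rewrite -wa wS2.
Qed.

(** The entry vertex of a slot lies outside the remainder of the path. The bound makes a choice with
    the most slots possible. *)
Lemma slotted_card p a b S : slotted l p a b S -> p <= #|S|.
Proof.
elim=> {p a b S} // p a a' b' c S1 D S2 h1 cD hD aD bD ab hS2 IH m1 m2 dis.
have : #|a' |: S2| <= #|S1 :|: D :|: S2|.
  by apply: subset_leq_card; apply: setSU; rewrite sub1set inE aD orbT.
rewrite cardsU1; have /negbTE-> : a' \notin S2.
  by apply/negP=> h; move: ab; rewrite (m2 _ aD h) eqxx.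
by rewrite /=; move: IH; clear; lia.
Qed.

End Paths.

(** * Necklaces of red cliques *)

Section Strands.

Variables (T : finType) (k : nat) (red : {set T} -> bool).
Hypothesis hk : 3 <= k.
Variables (l q0 : nat).
Hypothesis hl : l = q0.+1 * k.-1 + 1.
Implicit Types (A B D E G S Q e f g : {set T}) (a b x y z : T).

(* A strand is a red path [body] from [tip] to [root] leaving a red clique [core] at [root];
   it is looped when it also comes back to the core at [tip], so that [body] and [core]
   form a closed necklace. The path still runs through [slots] intact cliques of size [l]. *)
Record strand := Strand { slots : nat; tip : T; root : T; body : {set T}; core : {set T} }.

Implicit Types s : strand.

Definition dom s := body s :|: core s.

Definition looped s : bool := tip s \in core s.

Definition inner s z : bool := [&& z \in core s, z != tip s & z != root s].

Definition is_strand s : Prop :=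
  [/\ slotted k red l (slots s) (tip s) (root s) (body s), clique k red (core s),
      root s \in core s, tip s != root s &
      forall z, z \in body s -> z \in core s -> z = tip s \/ z = root s].

Lemma strand_rpath s : is_strand s -> rpath k red (tip s) (root s) (body s).
Proof. by case=> h _ _ _ _; exact (slotted_rpath hk hl h). Qed.

Lemma inner_body s z : is_strand s -> inner s z -> z \notin body s.
Proof.
case=> _ _ _ _ h /and3P[zD /eqP zx /eqP zy]; apply/negP=> zS.
by case: (h z zS zD).
Qed.

Lemma inner_dom s z : inner s z -> z \in dom s.
Proof. by case/andP=> zD _; rewrite inE zD orbT. Qed.

(** An edge [E] of the core leads from the root to [d1], then [G] leads to [d2], the new root.
    Vertices of [G] outside the strand are thereby absorbed, at the cost of core vertices in [E] and
    [G]; the tip is avoided, so a closed necklace stays closed. *)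
Lemma detour s d1 d2 G : is_strand s -> 4 * k <= #|core s| -> rpath k red d1 d2 G ->
  inner s d1 -> inner s d2 -> #|G| <= 2 * k ->
  (forall z, z \in G -> z \in dom s -> inner s z) ->
  exists s', [/\ is_strand s', slots s' = slots s, looped s -> looped s',
    dom s' = dom s :|: G & #|core s| <= #|core s'| + 3 * k].
Proof.
move=> ok hD hG i1 i2 cG hGs.
have [hS cD yD xy mSD] := ok.
have /and3P[d1D d1x d1y] := i1; have /and3P[d2D d2x d2y] := i2.
pose D1 := core s :\: (tip s |: (G :\ d1)).
have cD1 : k <= #|D1|.
  have := card_setD_ge (core s) (tip s |: (G :\ d1)).
  have := cardsU1 (tip s) (G :\ d1); have := cardsD1 d1 G; rewrite -/D1.
  by move: hD cG hk; clear; case: (_ \notin _); lia.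
have D1D : {subset D1 <= core s} by move=> z; rewrite inE => /andP[].
have [|||E [hE yE d1E sE]] := @edge_in_clique T k red hk D1 (root s) d1 _ cD1.
- by apply: clique_sub D1D.
- rewrite !inE yD andbT negb_or eq_sym xy /=; apply/negP=> /andP[_ yG].
  by have := hGs _ yG; rewrite /inner inE yD orbT eqxx !andbF => /(_ isT).
- by rewrite !inE d1D eqxx (negbTE d1x).
have xE : tip s \notin E by apply/negP=> /sE; rewrite !inE eqxx.
have ED : {subset E <= core s} by move=> z /sE /D1D.
have mEG : meet_at E G d1.
  by move=> z /sE; rewrite !inE negb_or negb_and => /andP[/andP[_ /orP[/negPn/eqP//|/negbTE->]]].
have GS z : z \in G -> z \in body s -> False.
  move=> zG zS; have : inner s z by apply: hGs => //; rewrite inE zS.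
  by move/(inner_body ok); rewrite zS.
have xG : tip s \notin G.
  by apply/negP=> xG; apply: (GS _ xG); apply: rpath_l (strand_rpath ok).
have hQ : rpath k red (root s) d2 (E :|: G).
  by apply: rpath_cat hG mEG; apply: rpath_edge => //; rewrite eq_sym.
have mSQ : meet_at (body s) (E :|: G) (root s).
  move=> z zS; rewrite inE => /orP[zE|zG]; last by case: (GS z).
  by case: (mSD z zS (ED _ zE)) => // zx; rewrite -zx zE in xE.
exists (Strand (slots s) (tip s) d2 (body s :|: (E :|: G))
                (d2 |: (core s :\: (E :|: G)))); split=> //=.
- split=> /=.
  + exact: (slotted_cat hk hl hS hQ mSQ).
  + by apply: clique_sub cD _ => z; rewrite !inE => /orP[/eqP->//|/andP[]].
  + by rewrite !inE eqxx.
  + by rewrite eq_sym.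
  + move=> z zSQ; rewrite in_setU1 in_setD => /orP[/eqP->|/andP[zQ zD]]; first by right.
    move: zSQ; rewrite inE (negbTE zQ) orbF => zS.
    case: (mSD z zS zD) => [|zy]; first by left.
    by move: zQ; rewrite zy inE yE.
- by move=> xD; rewrite /looped /= !inE negb_or xE xG; move: xD; rewrite /looped => ->; rewrite orbT.
- rewrite /dom /=; apply/setP=> z; rewrite !inE.
  case zE: (z \in E); first by rewrite (ED _ zE) !orbT.
  case zG: (z \in G); rewrite ?orbT //= ?orbF.
  by case: eqP => [->|] //=; rewrite d2D !orbT.
- have := cardsU1 d2 (core s :\: (E :|: G)); have := card_setD_ge (core s) (E :|: G).
  have := card_setU_le E G; have [cE _] := hE.
  by rewrite cE !inE (rpath_r hG) orbT /= add1n; move: cG; clear; lia.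
Qed.

Lemma reach s d G : is_strand s -> k + #|G| < #|core s| -> inner s d ->
  d \notin G -> root s \notin G ->
  exists D0, [/\ {subset D0 <= core s}, (forall z, z \in D0 -> z \notin G),
    rpath k red (tip s) d (body s :|: D0) &
    #|dom s| <= #|body s :|: D0| + #|G| + (k - 2)].
Proof.
move=> ok hD di dG yG; have [hS cD yD xy mSD] := ok.
have /and3P[dD dx dy] := di.
pose D1 := core s :\: (tip s |: G).
have cD1 : k <= #|D1|.
  have := card_setD_ge (core s) (tip s |: G); have := cardsU1 (tip s) G; rewrite -/D1.
  by move: hD; clear; case: (_ \notin _); lia.
have D1D : {subset D1 <= core s} by move=> z; rewrite inE => /andP[].
have [||||D0 [hD0 sD0 cD0]] := @rpath_in_clique T k red hk D1 (root s) d _ cD1.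
- by apply: clique_sub D1D.
- by rewrite !inE yD eq_sym negb_or xy yG.
- by rewrite !inE dD negb_or dx dG.
- by rewrite eq_sym.
exists D0; split.
- by move=> z /sD0/D1D.
- by move=> z /sD0; rewrite !inE negb_or => /andP[/andP[]].
- apply: rpath_cat (strand_rpath ok) hD0 _ => z zS /sD0 zD1.
  case: (mSD z zS (D1D _ zD1)) => // zx.
  by move: zD1; rewrite zx !inE eqxx.
- have : #|dom s| <= #|(body s :|: D0) :|: (G :|: (D1 :\: D0))|.
    apply: subset_leq_card; apply/subsetP=> z; rewrite /dom !inE.
    case zS: (z \in body s) => //= zD; rewrite zD.
    case: (z \in D0) => //=; case: (z \in G) => //=.
    rewrite !orbF andbT; apply/eqP=> zx.
    by move: zS; rewrite zx (rpath_l (strand_rpath ok)).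
  have := card_setU_le (body s :|: D0) (G :|: (D1 :\: D0)).
  have := card_setU_le G (D1 :\: D0).
  have := cardsD D1 D0; rewrite (setIidPr _); last by apply/subsetP.
  by move: cD0; clear; lia.
Qed.

Definition spanned (W : {set T}) : Prop :=
  exists a b Q, [/\ rpath k red a b Q, {subset Q <= W} & #|W| <= #|Q| + (k - 2)].

Lemma inner_ex s : 3 <= #|core s| -> exists d, inner s d.
Proof.
move=> h; have : 0 < #|core s :\: [set tip s; root s]|.
  by have := card_setD_ge (core s) [set tip s; root s]; rewrite cards2; case: (_ != _); lia.
case/card_gt0P=> d; rewrite !inE negb_or => /andP[/andP[h1 h2] h3].
by exists d; rewrite /inner h1 h2 h3.
Qed.

Lemma strand_spanned s : is_strand s -> k < #|core s| -> spanned (dom s).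
Proof.
move=> ok hD; have [d di] : exists d, inner s d by apply: inner_ex; lia.
have [|||D0 [s1 _ h hc]] := @reach s d set0 ok _ di; rewrite ?cards0 ?addn0 ?inE //.
exists (tip s), d, (body s :|: D0); split=> //.
- by move=> z; rewrite !inE => /orP[->//|/s1->]; rewrite orbT.
- by move: hc; rewrite cards0 addn0.
Qed.

(** The path of [reach] from the tip to [v] is prolonged by the edge, so [e] is covered entirely.
    The tip is left alone, so this also works for a strand already opened by [attach]. *)
Lemma attach_spanned s v e : is_strand s -> k < #|core s| -> inner s v ->
  red_edge k red (v |: e) -> e != set0 -> (forall z, z \in e -> z \notin dom s) ->
  spanned (dom s :|: e).
Proof.
move=> ok hD vi he /set0Pn[w we] dis.
have [|||D0 [s1 _ h hc]] := @reach s v set0 ok _ vi; rewrite ?cards0 ?addn0 ?inE //.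
have hmeet : meet_at (body s :|: D0) (v |: e) v.
  move=> z zB; rewrite !inE => /orP[/eqP//|/dis]; rewrite inE.
  by move: zB; rewrite inE => /orP[->|/s1->] //; rewrite orbT.
exists (tip s), w, ((body s :|: D0) :|: (v |: e)); split=> //.
- apply: rpath_cat h _ hmeet; apply: rpath_edge => //; rewrite ?inE ?eqxx ?we ?orbT //.
  by apply/eqP=> vw; move: (dis _ we); rewrite -vw inner_dom.
- move=> z; rewrite !inE => /orP[/orP[->//|/s1->]|/orP[/eqP->|->]]; rewrite ?orbT //.
  by have := inner_dom vi; rewrite !inE => ->.
- have -> : (body s :|: D0) :|: (v |: e) = (body s :|: D0) :|: e.
    apply/setP=> z; rewrite !inE; case: eqP => [->|] //=.
    by have := rpath_r h; rewrite !inE => ->.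
  rewrite (cardsU (dom s) e) (cardsU (body s :|: D0) e); move: hc; rewrite cards0 addn0.
  have -> : dom s :&: e = set0.
    by apply/setP=> z; rewrite !inE; apply/negbTE/negP=> /andP[h1 /dis]; rewrite !inE h1.
  have -> : (body s :|: D0) :&: e = set0.
    apply/setP=> z; rewrite !inE; apply/negbTE/negP=> /andP[h1 /dis].
    by rewrite !inE; case/orP: h1 => [->|/s1->] //; rewrite orbT.
  by rewrite !cards0 !subn0; lia.
Qed.

(** The necklace is opened at its tip: an edge [E] of the core leads from the tip to [v], and the
    red edge on [v] and [e] goes out to a new tip [w] outside the core. *)
Lemma attach s v e : is_strand s -> looped s -> 3 * k <= #|core s| -> inner s v ->
  red_edge k red (v |: e) -> e != set0 -> (forall z, z \in e -> z \notin dom s) ->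
  exists s', [/\ is_strand s', dom s' = dom s :|: e & #|core s| <= #|core s'| + k].
Proof.
move=> ok xD hD vi he /set0Pn[w we] dis; have [hS cD yD xy mSD] := ok.
have /and3P[vD vx vy] := vi.
have vS := inner_body ok vi.
pose D1 := core s :\ root s.
have D1D : {subset D1 <= core s} by move=> z; rewrite inE => /andP[].
have [||||E [hE vE xE sE]] := @edge_in_clique T k red hk D1 v (tip s).
- by apply: clique_sub D1D.
- by have := cardsD1 (root s) (core s); rewrite yD /D1; move: hD hk; clear; lia.
- by rewrite !inE vD vy.
- by rewrite !inE xy.
have yE : root s \notin E by apply/negP=> /sE; rewrite !inE eqxx.
have ED : {subset E <= core s} by move=> z /sE/D1D.
have wv : w != v by apply/eqP=> wv; move: (dis _ we); rewrite wv inner_dom.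
have mES : meet_at E (body s) (tip s).
  by move=> z zE zS; case: (mSD z zS (ED _ zE)) => // zy; rewrite -zy zE in yE.
have h1 : slotted k red l (slots s) v (root s) (E :|: body s).
  by apply: slotted_pre hS mES; apply: rpath_edge.
have h2 : slotted k red l (slots s) w (root s) ((v |: e) :|: (E :|: body s)).
  apply: slotted_pre h1 _; first by apply: rpath_edge => //; rewrite !inE ?eqxx ?we ?orbT.
  move=> z; rewrite !inE => /orP[/eqP//|ze] /orP h; case/negP: (dis _ ze).
  by rewrite inE; case: h => [/ED->|->] //; rewrite orbT.
exists (Strand (slots s) w (root s) ((v |: e) :|: (E :|: body s)) (core s :\: E)).
split.
- split=> //=.
  + by apply: clique_sub cD _ => z; rewrite inE => /andP[].
  + by rewrite inE yE.
  + by apply/eqP=> wy; move: (dis _ we); rewrite wy !inE yD orbT.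
  + move=> z; rewrite !inE => /orP[/orP[/eqP->|ze]|/orP[->|zS]] /andP[zE zD] //.
    * by rewrite vE in zE.
    * by move: (dis _ ze); rewrite !inE zD orbT.
    * case: (mSD z zS zD) => [zx|]; last by right.
      by rewrite zx xE in zE.
- rewrite /dom /=; apply/setP=> z; rewrite !inE.
  case zE: (z \in E); first by rewrite (ED _ zE) !orbT.
  case zS: (z \in body s); rewrite ?orbT //=.
  case: eqP => [->|_] /=; first by rewrite vD.
  by rewrite orbF orbC.
- by have := card_setD_ge (core s) E; have [-> _] := hE.
Qed.

(** The first slot becomes the core, of full size [l], and the old core is crossed from root to tip
    by an ordinary path, which misses at most $k-2$ vertices. *)
Lemma rotate s p : is_strand s -> looped s -> slots s = p.+1 -> k <= #|core s| ->
  exists s', [/\ is_strand s', looped s', slots s' = p & #|core s'| = l] /\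
    {subset dom s' <= dom s} /\ #|dom s| <= #|dom s'| + (k - 2).
Proof.
move=> ok xD sp hD; have [hS cD yD xy mSD] := ok; rewrite sp in hS.
have [a' [b' [S1 [D0 [S2 [[eS cD0 hD0 [aD bD ab]] [h1 hS2 m1 m2 dis]]]]]]] := slotted_inv hS.
have S1S z : z \in S1 -> z \in body s by rewrite eS !inE => ->.
have S2S z : z \in S2 -> z \in body s by rewrite eS !inE => ->; rewrite orbT.
have D0S z : z \in D0 -> z \in body s by rewrite eS !inE => ->; rewrite orbT.
have [|D1 [hD1 sD1 cD1]] := rpath_in_clique hk cD hD yD xD; first by rewrite eq_sym.
have xS1 := rpath_l h1.
have yS2 := rpath_r (slotted_rpath hk hl hS2).
have nS z : z \in S1 -> z \in S2 -> False by move=> /dis/negP.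
have mD1 : meet_at D1 S1 (tip s).
  move=> z /sD1 zD zS1; case: (mSD z (S1S _ zS1) zD) => // zy.
  by case: (nS z zS1); rewrite zy.
have mS2 : meet_at S2 (D1 :|: S1) (root s).
  move=> z zS2; rewrite inE => /orP[/sD1 zD|/nS//].
  by case: (mSD z (S2S _ zS2) zD) => // zx; case: (nS z) => //; rewrite zx.
(* The new body runs from [b'] along [S2] to the old root, through the old core to the old tip, and
   along [S1] to [a']; both ends lie in [D0]. *)
exists (Strand p b' a' (S2 :|: (D1 :|: S1)) D0); split; [split=> //=|split].
- split=> //=.
  + apply: (slotted_cat hk hl hS2 _ mS2); exact: (rpath_cat hD1 h1 mD1).
  + by rewrite eq_sym.
  + move=> z; rewrite !inE => /or3P[zS2|/sD1 zD|zS1] zD0; first by left; apply: m2.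
      case: (mSD z (D0S _ zD0) zD) => zE; first by right; apply: m1; rewrite // zE.
      by left; apply: m2; rewrite // zE.
    by right; apply: m1.
- move=> z; rewrite !inE => /orP[/or3P[/S2S->|/sD1->|/S1S->]|/D0S->]; rewrite ?orbT //.
- have : #|dom s| <= #|dom (Strand p b' a' (S2 :|: (D1 :|: S1)) D0) :|: (core s :\: D1)|.
    apply: subset_leq_card; apply/subsetP=> z; rewrite /dom /= eS !inE.
    by case: (z \in S1); case: (z \in S2); case: (z \in D0); case: (z \in D1); rewrite ?orbT //= orbF.
  have := card_setU_le (dom (Strand p b' a' (S2 :|: (D1 :|: S1)) D0)) (core s :\: D1).
  by have := cardsD (core s) D1; rewrite (setIidPr _); [move: cD1; clear; lia | apply/subsetP].
Qed.

End Strands.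

(** * Linking strands and lengthening a necklace *)

Section Linking.

Variables (T : finType) (k : nat) (red : {set T} -> bool).
Hypothesis hk : 3 <= k.
Variables (l q0 : nat).
Hypothesis hl : l = q0.+1 * k.-1 + 1.
Implicit Types (A B D E G S Q e f g : {set T}) (a b x y z : T) (s t : strand T).

Lemma slot_gt1 : 1 < l.
Proof. by rewrite hl addn1 ltnS muln_gt0; lia. Qed.

Lemma reach_along s d Q : is_strand k red l s -> 4 * k <= #|core s| -> inner s d ->
  d \in Q -> #|Q| <= 2 * k -> (forall z, z \in Q -> z \in dom s -> inner s z) ->
  exists A, [/\ rpath k red (tip s) d A, {subset A <= dom s}, meet_at A Q d &
    #|dom s| <= #|A| + 3 * k].
Proof.
move=> ok hD di dQ cQ hQ.
have cQd := cardsD1 d Q; rewrite dQ in cQd.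
have [|||D0 [s1 s2 h hc]] := reach hk hl (s := s) (d := d) (G := Q :\ d) ok _ di.
- by lia.
- by rewrite !inE eqxx.
- have [_ _ yD _ _] := ok; rewrite !inE negb_and; apply/orP; right; apply/negP=> yQ.
  by have := hQ _ yQ; rewrite /inner inE yD orbT eqxx !andbF => /(_ isT).
exists (body s :|: D0); split=> //.
- by move=> z; rewrite !inE => /orP[->//|/s1->]; rewrite orbT.
- move=> z; rewrite inE => /orP[zS|zD] zQ.
    by have := hQ _ zQ; rewrite inE zS => /(_ isT)/(inner_body ok); rewrite zS.
  by have := s2 _ zD; rewrite !inE zQ andbT => /negPn/eqP.
- by lia.
Qed.

(** In each strand a path runs from the tip to the end of [Q] there and misses at most $3k$
    vertices; [Q] joins the two. *)
Lemma link s t d d' Q : is_strand k red l s -> is_strand k red l t ->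
  4 * k <= #|core s| -> 4 * k <= #|core t| -> rpath k red d d' Q ->
  inner s d -> inner t d' -> #|Q| <= 2 * k ->
  (forall z, z \in Q -> z \in dom s -> inner s z) ->
  (forall z, z \in Q -> z \in dom t -> inner t z) ->
  (forall z, z \in dom s -> z \notin dom t) ->
  exists a b W, rpath k red a b W /\ #|dom s| + #|dom t| <= #|W| + 6 * k.
Proof.
move=> oks okt cs ct hQ di di' cQ hs ht dis.
have [A [hA sA mA cA]] := reach_along oks cs di (rpath_l hQ) cQ hs.
have [B [hB sB mB cB]] := reach_along okt ct di' (rpath_r hQ) cQ ht.
exists (tip s), (tip t), ((A :|: Q) :|: B); split.
  apply: rpath_cat (rpath_rev hB) _; first exact: rpath_cat hA hQ mA.
  move=> z; rewrite inE => /orP[/sA zA|zQ] zB; last exact: mB.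
  by move: (dis _ zA); rewrite sB.
have : #|A :|: B| <= #|A :|: Q :|: B|.
  by apply: subset_leq_card; apply: setSU; apply: subsetUl.
rewrite cardsU; suff -> : A :&: B = set0 by rewrite cards0; lia.
by apply/setP=> z; rewrite !inE; apply/negbTE/negP=> /andP[/sA/dis/negP h /sB].
Qed.

Definition fresh_link s A' g d a : Prop :=
  [/\ red_edge k red g, d \in g, a \in g, inner s d & a \in A'] /\
  (forall z, z \in g -> z \in dom s -> inner s z).

Lemma start_strand A m : clique k red A -> m + k <= #|A| -> 2 <= m ->
  exists s, [/\ is_strand k red l s, looped s, #|core s| = m, #|body s| = k &
    slots s = 0] /\ {subset dom s <= A}.
Proof.
clear hl q0 => cA hA hm.
have [||e [_ sA cE]] := @subset_between T set0 A k (sub0set _); rewrite ?cards0; try lia.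
have /card_gt0P[x xe] : 0 < #|e| by lia.
have [y] : exists y, y \in e :\ x by apply/card_gt0P; have := cardsD1 x e; rewrite xe; lia.
rewrite !inE => /andP[yx ye].
have seA := subsetP sA.
have [|||D [xD yD sD cD]] := @subset_card2 T (A :\: (e :\: [set x; y])) x y m.
- by rewrite !inE eqxx /= seA.
- by rewrite !inE eqxx orbT /= seA.
- have := card_setD_ge A (e :\: [set x; y]).
  by have := subset_leq_card (subsetDl e [set x; y]); lia.
exists (Strand 0 x y e D); split; last first.
  by move=> z; rewrite !inE => /orP[/seA//|/sD]; rewrite inE => /andP[].
split=> //; split=> /=; rewrite 1?eq_sym //.
- apply: slotted0; apply: rpath_edge => //; rewrite 1?eq_sym //.
  by split=> //; apply: cA.
- by apply: clique_sub cA _ => z /sD; rewrite inE => /andP[].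
- by move=> z ze /sD; rewrite !inE ze /= andbT negbK => /andP[/orP[]/eqP-> _]; [left|right].
Qed.

(* The core of [s] is turned into a slot and left through two links, so that the
   strand stays closed up, now at a core inside [A']. *)
Lemma lengthen s A' g1 g2 d1 d2 a1 a2 m : is_strand k red l s -> looped s ->
  l + 4 * k <= #|core s| -> clique k red A' -> m + 2 * k <= #|A'| -> 2 <= m ->
  (forall z, z \in A' -> z \notin dom s) ->
  (forall z, z \in g1 -> z \notin g2) ->
  fresh_link s A' g1 d1 a1 -> fresh_link s A' g2 d2 a2 ->
  exists s', [/\ is_strand k red l s', looped s', #|core s'| = m,
      #|body s'| <= #|body s| + l + 3 * k & slots s' = (slots s).+1] /\
    {subset dom s' <= dom s :|: (g1 :|: g2 :|: A')}.
Proof.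
move=> ok xD hD cA' hA' hm dA' dg [[[cg1 rg1] d1g a1g i1 a1A] hg1] [[[cg2 rg2] d2g a2g i2 a2A] hg2].
have hl2 := slot_gt1.
have [hS cD yD xy mSD] := ok.
have /and3P[d1D d1x d1y] := i1; have /and3P[d2D d2x d2y] := i2.
have g2n1 z : z \in g2 -> z \in g1 -> False by move=> zg2 /dg; rewrite zg2.
have ad d a : inner s d -> a \in A' -> d != a.
  by move=> di aA; apply/eqP=> da; move: (dA' _ aA); rewrite -da (inner_dom di).
have ng g z : (forall z, z \in g -> z \in dom s -> inner s z) -> z \in body s -> z \in g -> False.
  by move=> hg zS zg; have := hg _ zg; rewrite inE zS => /(_ isT)/(inner_body ok); rewrite zS.
have xS := rpath_l (strand_rpath hk hl ok); have yS := rpath_r (strand_rpath hk hl ok).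
have [|||D0 [d1D0 xD0 sD0 cD0]] :=
  @subset_card2 T (core s :\: (root s |: ((g1 :\ d1) :|: g2))) d1 (tip s) l.
- rewrite !inE eqxx d1D (negbTE d1y) /= andbT; apply/negP=> h; exact: g2n1 h d1g.
- rewrite !inE (negbTE xy) /= -/(looped s) xD andbT; apply/negP=> /orP[/andP[_]|]; exact: ng.
- have := card_setD_ge (core s) (root s |: ((g1 :\ d1) :|: g2)).
  have := cardsU1 (root s) ((g1 :\ d1) :|: g2); have := card_setU_le (g1 :\ d1) g2.
  by have := cardsD1 d1 g1; rewrite d1g cg1 cg2; move: hD hl2; clear; case: (_ \notin _); lia.
have D0D z : z \in D0 -> [/\ z \in core s, z != root s, z \in g1 -> z = d1 & z \notin g2].
  move=> /sD0; rewrite !inE !negb_or => /andP[/andP[h1 /andP[h2 h3]] h4]; split=> //.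
  by move=> zg1; move: h2; rewrite zg1 andbT => /negPn/eqP.
have [||||E [hE yE d2E sE]] :=
  @edge_in_clique T k red hk (core s :\: (D0 :|: (g1 :|: (g2 :\ d2)))) (root s) d2.
- by apply: clique_sub cD _ => z; rewrite inE => /andP[].
- have := card_setD_ge (core s) (D0 :|: (g1 :|: (g2 :\ d2))).
  have := card_setU_le D0 (g1 :|: (g2 :\ d2)); have := card_setU_le g1 (g2 :\ d2).
  by have := cardsD1 d2 g2; rewrite d2g cg1 cg2 cD0; move: hD; clear; lia.
- rewrite !inE yD andbT; apply/negP=> /or3P[/D0D[_]|h|/andP[_ h]]; rewrite ?eqxx //.
    exact: ng h.
  exact: ng h.
- rewrite !inE d2D eqxx andbT /= orbF; apply/negP=> /orP[/D0D[_ _ _]|]; rewrite ?d2g //.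
  exact: g2n1.
have ED z : z \in E -> [/\ z \in core s, z \notin D0, z \notin g1 & z \in g2 -> z = d2].
  move=> /sE; rewrite !inE !negb_or => /andP[/andP[h1 /andP[h2 h3]] h4]; split=> //.
  by move=> zg; move: h3; rewrite zg andbT => /negPn/eqP.
have [|||C [a1C a2C sC cC]] :=
  @subset_card2 T (A' :\: ((g1 :\ a1) :|: (g2 :\ a2))) a1 a2 m.
- rewrite !inE eqxx a1A /= andbT; apply/negP=> /andP[_ h]; exact: g2n1 h a1g.
- rewrite !inE eqxx a2A /= andbT orbF; apply/negP=> /andP[_ h]; exact: g2n1 a2g h.
- have := card_setD_ge A' ((g1 :\ a1) :|: (g2 :\ a2)).
  have := card_setU_le (g1 :\ a1) (g2 :\ a2).
  by have := cardsD1 a1 g1; have := cardsD1 a2 g2; rewrite a1g a2g cg1 cg2; move: hA' hm; clear; lia.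
have CA z : z \in C -> [/\ z \in A', z \in g1 -> z = a1 & z \in g2 -> z = a2].
  move=> /sC; rewrite !inE !negb_or => /andP[/andP[h1 h2] h3]; split=> // zg.
    by move: h1; rewrite zg andbT => /negPn/eqP.
  by move: h2; rewrite zg andbT => /negPn/eqP.
have xE : tip s \notin E by apply/negP=> /ED[_]; rewrite xD0.
have h2 : slotted k red l (slots s) (tip s) d2 (body s :|: E).
  apply: (slotted_cat hk hl hS); first by apply: rpath_edge; rewrite // eq_sym.
  by move=> z zS zE; have [zD _ _ _] := ED z zE; case: (mSD z zS zD) => // zx; rewrite -zx zE in xE.
have h3 : slotted k red l (slots s) (tip s) a2 ((body s :|: E) :|: g2).
  apply: (slotted_cat hk hl h2); first by apply: rpath_edge; rewrite // ad.
  by move=> z; rewrite inE => /orP[zS|/ED[_ _ _ h]] // zg; case: (ng g2 z).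
(* The new body runs along [g1] from [a1] to [d1], through the slot [D0] to the old tip, along the
   old body to the old root, by [E] to [d2] and by [g2] to [a2]; the core [C] in [A'] contains [a1]
   and [a2]. *)
exists (Strand (slots s).+1 a1 a2 (g1 :|: D0 :|: ((body s :|: E) :|: g2)) C); split.
- split=> //=; last first.
    have := card_setU_le (g1 :|: D0) ((body s :|: E) :|: g2).
    have := card_setU_le g1 D0; have := card_setU_le (body s :|: E) g2.
    by have := card_setU_le (body s) E; have [cE _] := hE; rewrite cg1 cg2 cD0 cE; clear; lia.
  split=> //=.
  + apply: (slottedS (a' := d1) (b' := tip s)) h3 _ _ _ => //.
    * by apply: rpath_edge; rewrite // eq_sym ad.
    * by apply: clique_sub cD _ => z /D0D[].
    * by move=> z zg /D0D[_ _ h _]; apply: h.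
    * move=> z zD0; have [zD zy _ zg2] := D0D z zD0.
      rewrite !inE (negbTE zg2) orbF => /orP[zS|/ED[_]]; last by rewrite zD0.
      by case: (mSD z zS zD) => // zy'; rewrite zy' eqxx in zy.
    * move=> z zg1; rewrite !inE (negbTE (dg _ zg1)) orbF; apply/negP=> /orP[zS|/ED[_ _]].
        exact: (ng g1 z).
      by rewrite zg1.
  + by apply: clique_sub cA' _ => z /CA[].
  + by apply/eqP=> a12; apply: (g2n1 a1) => //; rewrite a12.
  + move=> z; rewrite !inE => zB zC; have [zA z1 z2] := CA z zC.
    have zd := dA' _ zA; case/orP: zB => [/orP[/z1|zD0]|/orP[/orP[zS|zE]|/z2]]; try by [left|right].
    * by have [zD _ _ _] := D0D z zD0; move: zd; rewrite !inE zD orbT.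
    * by move: zd; rewrite !inE zS.
    * by have [zD _ _ _] := ED z zE; move: zd; rewrite !inE zD orbT.
- move=> z; rewrite !inE => /orP[/orP[/orP[->|/D0D[->]]|/orP[/orP[->|/ED[->]]|->]]|/CA[->]];
  by rewrite ?orbT.
Qed.

End Linking.

(** * Hypergraph Ramsey theorem, chromatic number and sigma *)

Lemma card_bigcup_le (I T : finType) (P : pred I) (F : I -> {set T}) :
  #|\bigcup_(i | P i) F i| <= \sum_(i | P i) #|F i|.
Proof.
apply: (big_ind2 (fun (A : {set T}) m => #|A| <= m)) => // [|A m B n hA hB].
  by rewrite cards0.
by apply: leq_trans (card_setU_le A B) _; apply: leq_add.
Qed.

Lemma clique_setU1 (T : finType) k (c : {set T} -> bool) (y : T) (D : {set T}) :
  clique k.+1 c D -> clique k (fun e => c (y |: e)) D -> clique k.+1 c (y |: D).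
Proof.
move=> h1 h2 e sub ce; case ye: (y \in e).
  rewrite -(setD1K ye); apply: h2; last by have := cardsD1 y e; rewrite ye; lia.
  apply/subsetP=> z; rewrite !inE => /andP[zy /(subsetP sub)].
  by rewrite !inE (negbTE zy).
apply: h1 => //; apply/subsetP=> z ze; have := subsetP sub _ ze.
by rewrite !inE => /orP[/eqP zy|//]; rewrite zy ye in ze.
Qed.

(** Induction on [k], then on [s] and [t]: the colours of the sets [y |: e] colour the $k$-sets of
    the other vertices, so a set of size [R1] or [R2] is homogeneous for them, and in it the bound
    for a smaller [s] or [t] applies. *)
Lemma hypergraph_ramsey k s t : exists R, forall (T : finType) (Y : {set T})
  (c : {set T} -> bool), R <= #|Y| ->
  exists D : {set T}, {subset D <= Y} /\
   ((#|D| = s /\ clique k c D) \/ (#|D| = t /\ clique k (fun e => ~~ c e) D)).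
Proof.
elim: k s t => [|k IHk] s t.
  exists (s + t) => T Y c hY.
  have get m : m <= s + t -> exists D : {set T}, {subset D <= Y} /\ #|D| = m.
    move=> hm; have [||D [_ sD cD]] := @subset_between T set0 Y m (sub0set _).
    - by rewrite cards0.
    - exact: leq_trans hm hY.
    by exists D; split=> //; apply/subsetP.
  case c0: (c set0).
    have [|D [sD cD]] := get s; first by lia.
    by exists D; split=> //; left; split=> // e _ /cards0_eq->.
  have [|D [sD cD]] := get t; first by lia.
  by exists D; split=> //; right; split=> // e _ /cards0_eq->; rewrite c0.
elim: s t => [|s IHs] t.
  exists 0 => T Y c _; exists set0; split; first by move=> z; rewrite inE.
  left; rewrite cards0; split=> // e; rewrite subset0 => /eqP->.
  by rewrite cards0.
elim: t => [|t IHt].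
  exists 0 => T Y c _; exists set0; split; first by move=> z; rewrite inE.
  right; rewrite cards0; split=> // e; rewrite subset0 => /eqP->.
  by rewrite cards0.
have [R1 h1] := IHs t.+1; have [R2 h2] := IHt; have [R h] := IHk R1 R2.
exists R.+1 => T Y c hY.
have /card_gt0P[y yY] : 0 < #|Y| by lia.
have [|D [sD hD]] := h T (Y :\ y) (fun e => c (y |: e)).
  by have := cardsD1 y Y; rewrite yY; lia.
have sDY z : z \in D -> z \in Y by move/sD; rewrite inE => /andP[].
have yD : y \notin D by apply/negP=> /sD; rewrite !inE eqxx.
have ext (E : {set T}) : {subset E <= D} ->
    {subset y |: E <= Y} /\ #|y |: E| = #|E|.+1.
  move=> sE; split; first by move=> z; rewrite !inE => /orP[/eqP->|/sE/sDY].
  by rewrite cardsU1; case: (boolP (y \in E)) => [/sE|//]; rewrite (negbTE yD).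
case: hD => [[cD kD]|[cD kD]].
  have [|E [sE [[cE kE]|[cE kE]]]] := h1 T D c; first by rewrite cD.
    have [e1 e2] := ext E sE; exists (y |: E); split=> //; left.
    by rewrite e2 cE; split=> //; apply: clique_setU1 kE (clique_sub kD sE).
  by exists E; split; [move=> z /sE/sDY | right].
have [|E [sE [[cE kE]|[cE kE]]]] := h2 T D c; first by rewrite cD.
  by exists E; split; [move=> z /sE/sDY | left].
have [e1 e2] := ext E sE; exists (y |: E); split=> //; right.
rewrite e2 cE; split=> //.
exact: (@clique_setU1 _ _ (fun e => ~~ c e)) kE (clique_sub kD sE).
Qed.

(** * Proper colourings of $H$ and red edges crossing a family of sets *)

Section Target.

Variables (k : nat) (V : finType) (H : {set {set V}}).
Hypothesis hk : 3 <= k.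
Hypothesis hH : uniform k H.
Hypothesis hV : 0 < #|V|.

Lemma colourable_card : colourable H #|V|.
Proof.
apply/existsP; exists [ffun v => enum_rank v]; apply/forallP=> e; apply/implyP=> eH.
have ce := hH eH; have /card_gt0P[x xe] : 0 < #|e| by lia.
have [y] : exists y, y \in e :\ x by apply/card_gt0P; have := cardsD1 x e; rewrite xe; lia.
rewrite !inE => /andP[yx ye].
apply/existsP; exists x; rewrite xe; apply/existsP; exists y; rewrite ye !ffunE.
by apply/eqP=> /enum_rank_inj xy; rewrite xy eqxx in yx.
Qed.

Lemma chi_colourable : colourable H (chi H).
Proof.
have h : has (colourable H) (iota 0 #|V|.+1).
  by apply/hasP; exists #|V|; [rewrite mem_iota; lia | apply: colourable_card].
have := nth_find 0 h; rewrite nth_iota // -[X in _ < X](size_iota 0 #|V|.+1).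
by rewrite -has_find.
Qed.

Lemma colourable_lt c : c < chi H -> ~~ colourable H c.
Proof.
move=> hc; have := before_find 0 hc; rewrite nth_iota ?add0n => [->//|].
apply: leq_trans hc _; rewrite -[X in _ <= X](size_iota 0 #|V|.+1); exact: find_size.
Qed.

Lemma chi_gt0 : 0 < chi H.
Proof.
case E: (chi H) => //; have := chi_colourable; rewrite E => /existsP[f _].
by have /card_gt0P[v _] := hV; case: (f v).
Qed.

(** The inequality also covers the default value [#|V|] of the minima, for which any proper
    colouring and any class will do. *)
Lemma sigma_attained : exists f : {ffun V -> 'I_(chi H)}, exists i,
  proper H f /\ #|[set v | f v == i]| <= sigma H.
Proof.
have /existsP[f0 pf0] := chi_colourable.
rewrite /sigma; elim/big_ind: _ => [|a b [f [i [pf hf]]] [g [j [pg hg]]]|f pf].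
- by exists f0, (Ordinal chi_gt0); rewrite max_card.
- by case: (leqP a b) => _; [exists f, i | exists g, j].
- exists f; suff [i hi] : exists i, #|[set v | f v == i]| <=
      \big[minn/#|V|]_(i : 'I_(chi H)) #|[set v | f v == i]| by exists i.
  elim/big_ind: _ => [|a b [i hi] [j hj]|i _]; last by exists i.
    by exists (Ordinal chi_gt0); rewrite max_card.
  by case: (leqP a b) => _; [exists i | exists j].
Qed.

(* An empty colour class could be dropped, contradicting the minimality of chi. *)
Lemma colour_class_nonempty (f : {ffun V -> 'I_(chi H)}) i :
  proper H f -> 0 < #|[set v | f v == i]|.
Proof.
move=> pf; rewrite lt0n; apply/negP=> /eqP/cards0_eq h0.
have fi v : f v != i by apply/negP=> h; have := in_set0 v; rewrite -h0 inE h.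
suff : colourable H (chi H).-1 by apply/negP/colourable_lt; have := chi_gt0; lia.
apply/existsP.
have hg v : exists j : 'I_(chi H).-1, lift i j == f v.
  by case: (unliftP i (f v)) => [j ->|/eqP]; [exists j | rewrite (negbTE (fi v))].
exists [ffun v => xchoose (hg v)].
apply/forallP=> e; apply/implyP=> eH; move/forallP/(_ e)/implyP/(_ eH): pf.
case/existsP=> x /andP[xe /existsP[y /andP[ye fxy]]].
apply/existsP; exists x; rewrite xe; apply/existsP; exists y; rewrite ye !ffunE.
apply: contraNneq fxy => exy.
by rewrite -(eqP (xchooseP (hg x))) -(eqP (xchooseP (hg y))) exy.
Qed.

Lemma sigma_gt0 : 0 < sigma H.
Proof.
have [f [i [pf hf]]] := sigma_attained.
exact: leq_trans (colour_class_nonempty i pf) hf.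
Qed.

Lemma sigma_le : sigma H <= #|V|.
Proof.
rewrite /sigma; elim/big_ind: _ => // [a b ha hb|f _]; first by rewrite geq_min ha.
by elim/big_ind: _ => // [a b ha hb|i _]; [rewrite geq_min ha | rewrite max_card].
Qed.

(** Embed $H$ class by class, the smallest class of an optimal colouring going to the last set,
    where only [sigma H] vertices are granted. If the copy is not blue it has a red edge, which
    meets two of the sets because the colouring is proper. *)
Lemma crossing_edge (T : finType) (c : {set T} -> bool) (W : nat -> {set T}) :
  (forall i j z, i < j <= (chi H).-1 -> z \in W i -> z \notin W j) ->
  (forall i, i < (chi H).-1 -> #|V| <= #|W i|) -> sigma H <= #|W (chi H).-1| ->
  (exists phi : V -> T, injective phi /\ forall e, e \in H -> c (phi @: e) = false) \/
  exists g i j a b, [/\ i < j <= (chi H).-1, red_edge k c g, a \in g /\ a \in W i,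
     b \in g /\ b \in W j & forall z, z \in g -> exists2 m, i <= m <= (chi H).-1 & z \in W m].
Proof.
move=> dis hW hWr; have [f [i0 [pf hf]]] := sigma_attained.
set r := (chi H).-1 in dis hW hWr *.
have chiE : chi H = r.+1 by have := chi_gt0; rewrite /r; lia.
(* The transposition of [i0] with the last index sends the smallest class to [W r]. *)
pose p (i : 'I_(chi H)) : nat := if i == i0 then r else if i == r :> nat then i0 else i.
have p_le i : p i <= r.
  by rewrite /p; case: eqP => // _; case: eqP => _; rewrite -ltnS -chiE.
have p_inj : injective p.
  move=> i j; rewrite /p; case: (i =P i0) => [->|ni]; case: (j =P i0) => [->|nj] //.
  - by case: eqP => [jr e0|hn e0]; [apply: val_inj; rewrite /= jr e0 | case: hn].
  - by case: eqP => [ir e0|hn e0]; [apply: val_inj; rewrite /= ir e0 | case: hn].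
  - case: eqP => ei; case: eqP => ej e0; apply: val_inj => //=; first by rewrite ei ej.
      by case: nj; apply: val_inj.
    by case: ni; apply: val_inj.
have hclass i : #|[set v | f v == i]| <= #|W (p i)|.
  rewrite /p; case: eqP => [->|ni]; first exact: leq_trans hf hWr.
  apply: leq_trans (max_card _) (hW _ _).
  have hi : i <= r by rewrite -ltnS -chiE.
  have hi0 : i0 <= r by rewrite -ltnS -chiE.
  case: (i =P r :> nat) => [ir|]; last by lia.
  suff : i0 <> r :> nat by lia.
  by move=> e; apply: ni; apply: val_inj; rewrite /= ir.
have idx v : index v (enum [set w | f w == f v]) < #|W (p (f v))|.
  by apply: leq_trans (hclass (f v)); rewrite cardE index_mem mem_enum inE.
have [x0 _] : exists x0 : T, x0 \in setT.
  have /card_gt0P[v _] := hV; have : 0 < #|W (p (f v))| by apply: leq_trans (idx v).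
  by case/card_gt0P=> x0 _; exists x0.
(* A vertex goes to the vertex of equal rank in the set assigned to its class. *)
pose phi v := nth x0 (enum (W (p (f v)))) (index v (enum [set w | f w == f v])).
have phiW v : phi v \in W (p (f v)) by rewrite -mem_enum mem_nth // -cardE.
have disj i j z : p i != p j -> z \in W (p i) -> z \in W (p j) -> False.
  case: ltngtP => // h _ z1 z2.
    by have := dis (p i) (p j) z; rewrite h p_le z2 => /(_ isT z1).
  by have := dis (p j) (p i) z; rewrite h p_le z1 => /(_ isT z2).
have phi_inj : injective phi.
  move=> v w e; case: (f v =P f w) => [fvw|/eqP nf]; last first.
    case: (@disj (f v) (f w) (phi v)); rewrite ?(inj_eq p_inj) //.
    by rewrite e.
  move: e; rewrite /phi fvw => /eqP; rewrite nth_uniq ?enum_uniq // -?cardE //; last first.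
    by have := idx v; rewrite fvw.
  by move/eqP/(index_inj v); apply; rewrite mem_enum inE ?fvw.
case: (classic (forall e, e \in H -> c (phi @: e) = false)) => [hb|]; first by left; exists phi.
move/not_all_ex_not => [e he]; have [eH ce] := imply_to_and _ _ he; right.
move/forallP/(_ e)/implyP/(_ eH): (pf) => /existsP[x /andP[xe /existsP[y /andP[ye fxy]]]].
have [v0 v0e hv0] := arg_minnP (fun v => p (f v)) xe.
have [w we fw] : exists2 w, w \in e & f w != f v0.
  case: (f x =P f v0) => [fx|/eqP]; last by exists x.
  by exists y; rewrite // -fx eq_sym.
exists (phi @: e), (p (f v0)), (p (f w)), (phi v0), (phi w); split.
- by rewrite p_le andbT ltn_neqAle hv0 // andbT (inj_eq p_inj) eq_sym.
- by split; [rewrite card_imset // hH | case: (c _) ce].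
- by rewrite imset_f.
- by rewrite imset_f.
- by move=> z /imsetP[v ve ->]; exists (p (f v)); rewrite // hv0 ?p_le.
Qed.

End Target.

(** * The function tau *)

Lemma bounded_max (P : nat -> Prop) B : P 0 -> (forall n, P n -> n <= B) ->
  exists M, P M /\ forall n, M < n -> ~ P n.
Proof.
move=> P0; elim: B => [|B IH] hB.
  by exists 0; split=> // n hn /hB; lia.
case: (classic (P B.+1)) => hP.
  by exists B.+1; split=> // n hn /hB; lia.
apply: IH => n Pn; have := hB n Pn; rewrite leq_eqVlt => /orP[/eqP e|//].
by rewrite e in Pn.
Qed.

Lemma classical_min (P : nat -> Prop) n : P n ->
  exists m, [/\ P m, m <= n & forall i, i < m -> ~ P i].
Proof.
elim/ltn_ind: n => n IH Pn.
case: (classic (exists2 i, i < n & P i)) => [[i hi Pi]|h].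
  have [m [Pm hm hmin]] := IH i hi Pi.
  by exists m; split=> //; apply: leq_trans hm (ltnW hi).
by exists n; split=> // i hi Pi; apply: h; exists i.
Qed.

Lemma indep_num_ge (V : finType) (E : {set {set V}}) (S : {set V}) :
  [forall e in E, ~~ (e \subset S)] -> #|S| <= indep_num E.
Proof. by move=> h; rewrite /indep_num; apply: (leq_bigmax_cond (F := fun S : {set V} => #|S|)). Qed.

(** Ensures that the maximum defining [tau] exists. Each vertex outside a maximum independent set
    [S] forms an edge with some $K \subseteq S$. For a fixed $K$, more than [alpha] such vertices
    would contain an edge $e$, and for $w \in e$ the edges $e$ and $\{w\} \cup K$ would meet in $w$
    alone. *)
Lemma tau_good_bounded j alpha N : 0 < j -> tau_good j alpha N ->
  N <= alpha + 2 ^ alpha * alpha.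
Proof.
move=> hj [E [uE [hE noone]]].
pose indep (S : {set 'I_N}) := [forall e in E, ~~ (e \subset S)].
have ub S : indep S -> #|S| < alpha by move/indep_num_ge => h; apply: leq_ltn_trans hE.
have i0 : indep set0.
  apply/forallP=> e; apply/implyP=> eE; apply/negP; rewrite subset0 => /eqP e0.
  by have := uE _ eE; rewrite e0 cards0; lia.
have [S iS maxS] := arg_maxnP (fun S : {set 'I_N} => #|S|) i0.
have cS := ub _ iS.
have dep (U : {set 'I_N}) : alpha <= #|U| -> exists2 e, e \in E & e \subset U.
  move=> hU; case: (boolP (indep U)) => [/ub|]; first by lia.
  by rewrite negb_forall => /existsP[e]; rewrite negb_imply negbK => /andP[]; exists e.
have ext v : v \notin S -> exists2 K : {set 'I_N}, K \subset S & (v |: K) \in E.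
  move=> vS; have : ~~ indep (v |: S).
    by apply/negP=> /maxS; rewrite cardsU1 vS; lia.
  rewrite negb_forall => /existsP[e]; rewrite negb_imply negbK => /andP[eE sub].
  have ve : v \in e.
    apply/negPn/negP=> ve; move/forallP/(_ e)/implyP/(_ eE)/negP: iS; apply.
    apply/subsetP=> z ze; have := subsetP sub _ ze; rewrite !inE => /orP[/eqP zv|//].
    by rewrite -zv ze in ve.
  exists (e :\ v); last by rewrite setD1K.
  apply/subsetP=> z; rewrite !inE => /andP[zv /(subsetP sub)].
  by rewrite !inE (negbTE zv).
pose fib (K : {set 'I_N}) := [set v | (v \notin S) && ((v |: K) \in E)].
have cfib K : K \in powerset S -> #|fib K| <= alpha.
  rewrite inE => KS; rewrite leqNgt; apply/negP=> /ltnW/dep[e eE sub].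
  have /card_gt0P[w we] : 0 < #|e| by rewrite uE.
  have := subsetP sub _ we; rewrite inE => /andP[wS wK].
  case/negP: (noone _ _ wK eE); rewrite (_ : (w |: K) :&: e = [set w]) ?cards1 //.
  apply/setP=> z; rewrite !inE; case: (z =P w) => [->|] //=.
  move=> _; apply/negbTE/negP=> /andP[/(subsetP KS) zS /(subsetP sub)].
  by rewrite inE zS.
have : #|~: S| <= 2 ^ alpha * alpha.
  apply: (@leq_trans #|\bigcup_(K in powerset S) fib K|).
    apply: subset_leq_card; apply/subsetP=> v; rewrite inE => vS.
    have [K KS vK] := ext v vS; apply/bigcupP; exists K; rewrite inE //.
    by rewrite vS.
  apply: leq_trans (card_bigcup_le _ _) _.
  apply: (@leq_trans (\sum_(K in powerset S) alpha)); first exact: leq_sum.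
  by rewrite sum_nat_const card_powerset leq_mul2r leq_exp2l // (ltnW cS) orbT.
have := cardsC S; rewrite card_ord; lia.
Qed.

Lemma tau_spec j alpha : 0 < j -> 0 < alpha ->
  tau_good j alpha (tau j alpha) /\ forall M, tau j alpha < M -> ~ tau_good j alpha M.
Proof.
move=> hj ha; rewrite /tau; apply epsilon_spec.
apply: (@bounded_max _ (alpha + 2 ^ alpha * alpha)); last first.
  by move=> n; apply: tau_good_bounded.
exists set0; split; first by move=> e; rewrite inE.
split; last by move=> e f; rewrite inE.
rewrite /indep_num; apply: leq_ltn_trans ha; apply/bigmax_leqP=> S _.
by apply: leq_trans (max_card _) _; rewrite card_ord.
Qed.

Lemma card1_ex (T : finType) (A : {set T}) : #|A| = 1 ->
  exists2 w, w \in A & forall z, z \in A -> z = w.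
Proof.
by move/eqP/cards1P=> [w ->]; exists w; [rewrite inE | move=> z; rewrite inE => /eqP].
Qed.

(** Restricting [F] to $\tau+1$ points of [X] gives a hypergraph too large to be good: it has a
    large independent set or two edges meeting in exactly one vertex. *)
Lemma tau_set (T : finType) (X : {set T}) (F : pred {set T}) j alpha :
  0 < j -> 0 < alpha -> tau j alpha < #|X| ->
  (exists Y : {set T}, [/\ {subset Y <= X}, alpha = #|Y| &
      forall e : {set T}, {subset e <= Y} -> #|e| = j -> ~~ F e]) \/
  (exists (e f : {set T}) w, [/\ {subset e <= X}, {subset f <= X},
      #|e| = j /\ #|f| = j, F e /\ F f & meet_at e f w /\ w \in e /\ w \in f]).
Proof.
move=> hj ha hX; have [_ /(_ _ (ltnSn _)) nogood] := tau_spec hj ha.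
set t := (tau j alpha).+1 in nogood *.
pose psi (i : 'I_t) := enum_val (widen_ord hX i).
have psi_inj : injective psi by move=> i i' /enum_val_inj/(congr1 val) /= h; apply: val_inj.
have psiX i : psi i \in X by apply: enum_valP.
pose E := [set e : {set 'I_t} | (#|e| == j) && F (psi @: e)].
have uE : uniform j E by move=> e; rewrite inE => /andP[/eqP].
have subX (e : {set 'I_t}) : {subset psi @: e <= X} by move=> z /imsetP[i _ ->].
case: (ltnP (indep_num E) alpha) => hE.
  right; apply: NNPP => hno; apply: nogood; exists E; split=> //; split=> //.
  move=> e f; rewrite !inE => /andP[/eqP ce Fe] /andP[/eqP cf Ff].
  apply/negP=> /eqP/card1_ex[w]; rewrite inE => /andP[we wf] hw; apply: hno.
  exists (psi @: e), (psi @: f), (psi w); split=> //.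
  - by rewrite !card_imset.
  - rewrite !imset_f //; split=> // z /imsetP[i ie ->] /imsetP[i' if' /psi_inj e'].
    by congr psi; apply: hw; rewrite inE ie e'.
left; have [S iS cS] : exists2 S : {set 'I_t}, [forall e in E, ~~ (e \subset S)] & alpha <= #|S|.
  apply: NNPP => no; suff : indep_num E <= alpha.-1 by lia.
  apply/bigmax_leqP => S iS; rewrite leqNgt; apply/negP=> h; apply: no.
  by exists S => //; lia.
have [||Y [_ sY cY]] := @subset_between _ set0 (psi @: S) alpha (sub0set _).
- by rewrite cards0.
- by rewrite card_imset.
exists Y; split=> // [z /(subsetP sY)/subX //|e se ce]; apply/negP=> Fe.
have eS : psi @: (psi @^-1: e) = e.
  apply/setP=> z; apply/imsetP/idP => [[i]|ze]; first by rewrite inE => h ->.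
  have /imsetP[i _ zi] := subsetP sY _ (se _ ze).
  by exists i; rewrite // inE -zi.
move/forallP/(_ (psi @^-1: e))/implyP: iS; rewrite inE eS Fe andbT.
rewrite -(card_imset _ psi_inj) eS ce eqxx => /(_ isT)/negP; apply.
apply/subsetP=> i; rewrite inE => /se/(subsetP sY)/imsetP[i' i'S /psi_inj->//].
Qed.

(** * Copies of the loose path *)

Section PathCopy.

Variables (T : finType) (k : nat) (red : {set T} -> bool).
Hypothesis hk : 3 <= k.

(** Listed along the path, the edges become the windows of length [k] that start at multiples of
    $k-1$, as in [loose_path]. *)
Lemma rpath_seq a b (S : {set T}) : rpath k red a b S ->
  exists s, [/\ uniq (a :: s), [set x in a :: s] = S &
    forall i, (i.+1 * k.-1 < #|S|) ->
      red [set x in take k (drop (i * k.-1) (a :: s))]].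
Proof.
elim=> {a b S} [a|a b d e S [ce re] ae be ab hS [s [us eS hs]] hm].
  exists [::]; split=> // [|i]; first by apply/setP=> z; rewrite !inE.
  by rewrite cards1; nia.
pose u := enum (e :\: [set a; b]).
have cu : size u = k.-2.
  rewrite -cardE cardsD (setIidPr _) ?ce ?cards2 ?ab; first by lia.
  by apply/subsetP=> z; rewrite !inE => /orP[/eqP->|/eqP->].
have eE : [set x in a :: u ++ [:: b]] = e.
  apply/setP=> z; rewrite !inE mem_cat mem_enum !inE.
  case: (z =P a) => [->|_]; first by rewrite ae.
  by case: (z =P b) => [->|_]; rewrite ?be /= ?orbT ?orbF.
have inS z : (z \in b :: s) = (z \in S) by rewrite -eS [in RHS]inE.
have aS : a \notin S by apply/negP=> aS; move: ab; rewrite (hm _ ae aS) eqxx.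
exists (u ++ b :: s); split.
- rewrite /= mem_cat negb_or inS aS andbT; apply/andP; split.
    by rewrite mem_enum !inE eqxx.
  rewrite cat_uniq enum_uniq us andbT; apply/hasPn=> z; rewrite inS mem_enum !inE => zS.
  by apply/negP=> /andP[/norP[_ /eqP zb] ze]; apply: zb; apply: hm.
- apply/setP=> z; rewrite -eE !inE !mem_cat inS mem_seq1 -!orbA.
  by case: (z =P b) => [->|] //=; rewrite -inS inE eqxx !orbT.
- case=> [|i] hi.
    rewrite mul0n drop0 -[k in take k](_ : size (a :: u ++ [:: b]) = k); last first.
      by rewrite /= size_cat cu /=; lia.
    have -> : a :: u ++ b :: s = (a :: u ++ [:: b]) ++ s by rewrite /= -catA.
    by rewrite take_size_cat // eE.
  have dk : i.+1 * k.-1 = i * k.-1 + size (a :: u) by rewrite /= cu; nia.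
  rewrite dk -drop_drop -cat_cons drop_size_cat //; apply: hs.
  have eI : #|e :&: S| = 1.
    rewrite (_ : e :&: S = [set b]) ?cards1 //; apply/setP=> z; rewrite !inE.
    by apply/andP/eqP => [[ze zS]|->]; [apply: hm | rewrite be (rpath_l hS)].
  by move: hi; rewrite cardsU eI ce; nia.
Qed.

Lemma rpath_copy a b (S : {set T}) n : rpath k red a b S -> n <= #|S| ->
  exists f : 'I_n -> T, injective f /\ forall e, e \in loose_path k n -> red (f @: e).
Proof.
move=> /rpath_seq[s [us eS hs]] hn.
have cS : #|S| = size (a :: s) by rewrite -eS cardsE; apply/card_uniqP.
exists (fun i => nth a (a :: s) i); split.
  move=> i j /eqP; rewrite nth_uniq // -?cS; first by move/eqP/val_inj.
    exact: leq_trans (ltn_ord i) hn.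
  exact: leq_trans (ltn_ord j) hn.
move=> e /imsetP[i _ ->].
have hi : i.+1 * k.-1 <= n.-1 by apply: leq_trans (leq_divM n.-1 k.-1); rewrite leq_mul2r ltn_ord orbT.
have hi' : i.+1 * k.-1 < n.
  have : 0 < i.+1 * k.-1 by rewrite muln_gt0; lia.
  by move: hi; lia.
have := hs i (leq_trans hi' hn); congr red; apply/setP=> z; rewrite inE.
apply/(nthP a)/imsetP => [[m]|[v]].
  rewrite size_take_min size_drop -cS => hm; rewrite nth_take; last by lia.
  rewrite nth_drop => <-.
  have hv : i * k.-1 + m < n by nia.
  by exists (Ordinal hv); rewrite // inE /=; lia.
rewrite inE => /andP[h1 h2] ->; exists (v - i * k.-1).
  by rewrite size_take_min size_drop -cS; have := ltn_ord v; lia.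
by rewrite nth_take ?nth_drop ?subnKC //; lia.
Qed.

End PathCopy.

Lemma ramsey_le k (VG : finType) (G : {set {set VG}}) (VH : finType) (H : {set {set VH}}) N :
  arrows k G H N -> ramsey k G H <= N.
Proof.
move=> hN; have [m [am hm hmin]] := classical_min hN.
rewrite /ramsey.
set P := fun N : nat => _ /\ _.
have [aR hR] : P (epsilon (inhabits 0) P) by apply epsilon_spec; exists m.
by apply: leq_trans hm; rewrite leqNgt; apply/negP=> /hR.
Qed.

(** * Families of strands *)

Section Families.

Variables (T : finType) (r : nat).
Implicit Types (W : nat -> {set T}).

Definition free W : {set T} := ~: \bigcup_(i < r) W i.

Definition packed W : Prop :=
  forall i j z, i < r -> j < r -> i != j -> z \in W i -> z \notin W j.

Lemma freeP W z : reflect (forall i, i < r -> z \notin W i) (z \in free W).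
Proof.
rewrite inE; apply: (iffP idP) => [h i hi|h].
  by apply/negP=> zi; case/negP: h; apply/bigcupP; exists (Ordinal hi).
by apply/negP=> /bigcupP[i _ zi]; case/negP: (h i (ltn_ord i)).
Qed.

Lemma card_free_ge W : #|T| <= #|free W| + \sum_(i < r) #|W i|.
Proof.
rewrite -(cardsC (\bigcup_(i < r) W i)) addnC leq_add2l; exact: card_bigcup_le.
Qed.

Lemma card_free W : packed W -> #|T| = #|free W| + \sum_(i < r) #|W i|.
Proof.
move=> pW; rewrite -(cardsC (free W)) /free setCK; congr (_ + _).
suff : forall m, m <= r -> #|\bigcup_(i < m) W i| = \sum_(i < m) #|W i| by apply.
elim=> [|m IH] hm; first by rewrite !big_ord0 cards0.
rewrite !big_ord_recr /= -IH ?(ltnW hm) // cardsU.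
suff -> : \bigcup_(i < m) W i :&: W m = set0 by rewrite cards0 subn0.
apply/setP=> z; rewrite !inE; apply/negbTE/negP=> /andP[/bigcupP[i _ zi]].
have hi := ltn_ord i; apply/negP; apply: (pW i m z _ _ _ zi) => //.
  exact: ltn_trans hi hm.
by rewrite neq_ltn hi.
Qed.

(** The deficits $b-F(i)$ and $b-F(j)$ together are at most the total deficit. *)
Lemma sum_two (F : nat -> nat) b i j : i < r -> j < r -> i != j ->
  (forall i, i < r -> F i <= b) -> \sum_(i < r) F i + 2 * b <= r * b + F i + F j.
Proof.
move=> hi hj ij hF.
have e : \sum_(i < r) F i + \sum_(i < r) (b - F i) = r * b.
  rewrite -big_split /= -[r in r * b](card_ord r) -sum_nat_const; apply: eq_bigr => l _.
  by have := hF l (ltn_ord l); lia.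
have : (b - F i) + (b - F j) <= \sum_(i < r) (b - F i).
  rewrite (bigD1 (Ordinal hi)) //= (bigD1 (Ordinal hj)) /=; last first.
    by apply/eqP=> /(congr1 val) /= ji; rewrite ji eqxx in ij.
  lia.
by have := hF i hi; have := hF j hj; lia.
Qed.

Definition update (A : Type) (f : nat -> A) i a : nat -> A :=
  fun j => if j == i then a else f j.

End Families.

(** * Configurations of strands in a colouring with neither a red path nor a blue $H$ *)

Section Configurations.

Variables (k : nat) (V : finType) (H : {set {set V}}).
Hypothesis hk : 3 <= k.
Hypothesis hH : uniform k H.
Hypothesis hV : 0 < #|V|.
Variables (T : finType) (red : {set T} -> bool) (n : nat).

Let r := (chi H).-1.
Let sg := sigma H.
Let ta := tau k.-1 (sigma H).
Let m := maxn (ta + 3 - 2 * k) sg.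

Hypothesis hn : exists q, n = q * k.-1 + 1.
Hypothesis hT : #|T| = r * n.-1 + m.
Hypothesis no_red : forall a b S, rpath k red a b S -> #|S| < n.
Hypothesis no_blue : ~ exists phi : V -> T,
  injective phi /\ forall e, e \in H -> red (phi @: e) = false.

Variables (l q0 : nat).
Hypothesis hl : l = q0.+1 * k.-1 + 1.

Implicit Types (C E G S Q U X Y e f g : {set T}) (a b v z : T) (s : strand T)
  (st : nat -> strand T).

Let strand_ok s := is_strand k red l s.

(** By the congruence a path of order below [n] has order at most $n-(k-1)$, so adding the $k-2$
    missed vertices does not reach [n]. *)
Lemma spanned_lt (W : {set T}) : spanned k red W -> #|W| < n.
Proof.
case=> a [b [Q [hQ _ hW]]]; have := no_red hQ; have [q qE] := rpath_card hk hQ.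
have [q' ->] := hn; rewrite qE in hW *; move=> h.
have : q < q' by rewrite ltnNge; apply/negP=> hqq; have := leq_mul2r k.-1 q' q; lia.
by nia.
Qed.

Lemma m_le_free (W : nat -> {set T}) : (forall i, i < r -> #|W i| < n) -> m <= #|free r W|.
Proof.
move=> hW; have := card_free_ge r W; rewrite hT.
have : \sum_(i < r) #|W i| <= r * n.-1.
  rewrite -[r in r * _](card_ord r) -sum_nat_const; apply: leq_sum => i _.
  by have := hW i (ltn_ord i); lia.
by lia.
Qed.

Definition config st M : Prop :=
  (forall i, i < r -> strand_ok (st i) /\ M <= #|core (st i)|) /\
  packed r (fun i => dom (st i)).

Definition closed st : Prop := forall i, i < r -> looped (st i).

Definition rest st : {set T} := free r (fun i => dom (st i)).

Definition clean st Q : Prop :=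
  forall i z, i < r -> z \in Q -> z \in dom (st i) -> inner (st i) z.

Lemma dom_lt st M i : config st M -> k < M -> i < r -> #|dom (st i)| < n.
Proof.
move=> [ok _] hM hi; have [oki hc] := ok i hi; apply: spanned_lt.
by apply: (strand_spanned hk hl oki); lia.
Qed.

Lemma m_le_rest st M : config st M -> k < M -> m <= #|rest st|.
Proof. by move=> cf hM; apply: m_le_free => i; apply: dom_lt cf hM. Qed.

(** One red path covers both linked strands up to $6k$ vertices, so together they have fewer than
    $n+6k$. As the others have fewer than [n] each, the rest would be larger than assumed. *)
Lemma not_linked st M i j a b Q : config st M -> 4 * k <= M ->
  #|rest st| + 6 * k + 2 <= n -> i < r -> j < r -> i != j ->
  rpath k red a b Q -> inner (st i) a -> inner (st j) b -> #|Q| <= 2 * k ->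
  clean st Q -> False.
Proof.
move=> cf hM hn' hi hj ij hQ ia jb cQ cl.
have [ok pk] := cf; have [oki ci] := ok i hi; have [okj cj] := ok j hj.
have [||||||||x [y [W [hW cW]]]] := @link T k red hk l q0 hl (st i) (st j) a b Q oki okj _ _ hQ.
- exact: leq_trans hM ci.
- exact: leq_trans hM cj.
- by [].
- by [].
- by [].
- by move=> z; apply: cl.
- by move=> z; apply: cl.
- by move=> z; apply: pk.
have hW' := no_red hW.
have hd i' : i' < r -> #|dom (st i')| <= n.-1.
  by move=> hi'; have := dom_lt cf _ hi'; lia.
have := sum_two hi hj ij hd; have := card_free pk; rewrite -/(rest st) hT.
by lia.
Qed.

Lemma cross_core st M X (U : nat -> {set T}) : config st M -> 4 * k <= M ->
  #|rest st| + 6 * k + 2 <= n -> {subset X <= rest st} -> sg <= #|X| ->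
  (forall i z, i < r -> z \in U i -> inner (st i) z) ->
  (forall i, i < r -> #|V| <= #|U i|) ->
  exists g i a b, [/\ i < r, red_edge k red g, a \in g /\ a \in U i, b \in g /\ b \in X &
    forall z, z \in g -> z \in U i \/ z \in X].
Proof.
move=> cf hM hn' sX cX hU cU; have [ok pk] := cf.
pose W i := if i < r then U i else X.
have WU i : i < r -> W i = U i by rewrite /W => ->.
have WX : W r = X by rewrite /W ltnn.
have XU i z : i < r -> z \in X -> z \in U i -> False.
  by move=> hi /sX/freeP/(_ i hi)/negP h /(hU _ _ hi)/inner_dom.
have UU i j z : i < r -> j < r -> z \in U i -> z \in dom (st j) -> i = j.
  move=> hi hj zi zj; apply/eqP/negPn/negP=> ij.
  by have := pk i j z hi hj ij; rewrite (inner_dom (hU i z hi zi)) zj => /(_ isT).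
have [|||//|[g [i [j [a [b [/andP[ij jr] rg [ag aW] [bg bW] gW]]]]]]] :=
    @crossing_edge k V H hk hH hV T red W.
- move=> i j z /andP[ij jr]; have hi := leq_trans ij jr; rewrite (WU i) // => zi.
  apply/negP; move: jr; rewrite leq_eqVlt => /orP[/eqP->|hj].
    by rewrite -/r WX => /XU/(_ zi); apply.
  by rewrite WU // => zj; have := UU i j z hi hj zi (inner_dom (hU _ _ hj zj)); lia.
- by move=> i hi; rewrite WU //; apply: cU.
- by rewrite -/r WX.
have hi : i < r := leq_trans ij jr.
rewrite WU // in aW.
have clg : clean st g.
  move=> i' z hi' zg zd; have [p /andP[_ pr] zW] := gW z zg.
  move: pr; rewrite leq_eqVlt => /orP[/eqP pE|hp].
    by move: zW; rewrite pE -/r WX => /sX/freeP/(_ i' hi'); rewrite zd.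
  by rewrite WU // in zW; rewrite -(UU p i' z) //; apply: hU.
have cg : #|g| <= 2 * k by have [-> _] := rg; lia.
have nolink p z : p < r -> z \in g -> z \in U p -> p != i -> False.
  move=> hp zg zp pi; have ci : i != p by rewrite eq_sym.
  apply: (not_linked cf hM hn' hi hp ci (a := a) (b := z) (Q := g)) => //.
  - apply: rpath_edge => //; apply/eqP=> az; case/eqP: ci.
    by apply: UU aW _ => //; rewrite az; apply: inner_dom (hU _ _ hp zp).
  - exact: hU.
  - exact: hU.
exists g, i, a, b; split=> //.
- split=> //; move: jr; rewrite leq_eqVlt => /orP[/eqP jE|hj]; first by move: bW; rewrite jE -/r WX.
  by rewrite WU // in bW; case: (nolink j b hj bg bW); lia.
- move=> z zg; have [p /andP[_ pr] zW] := gW z zg.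
  move: pr; rewrite leq_eqVlt => /orP[/eqP pE|hp]; first by right; move: zW; rewrite pE -/r WX.
  rewrite WU // in zW; case: (p =P i) => [pi|/eqP pi]; first by left; rewrite -pi.
  by case: (nolink p z).
Qed.

Definition extends st i s' : Prop :=
  [/\ strand_ok s', slots s' = slots (st i), looped (st i) -> looped s' &
      #|core (st i)| <= #|core s'| + 3 * k] /\
  [/\ {subset dom (st i) <= dom s'},
      (forall z, z \in dom s' -> z \in dom (st i) \/ z \in rest st) &
      #|dom (st i)| < #|dom s'| <= #|dom (st i)| + 2 * k].

Lemma absorb st M i a b w G : config st M -> 4 * k <= M -> i < r ->
  rpath k red a b G -> inner (st i) a -> inner (st i) b -> #|G| <= 2 * k ->
  (forall z, z \in G -> inner (st i) z \/ z \in rest st) ->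
  w \in G -> w \in rest st -> exists s', extends st i s'.
Proof.
move=> [ok pk] hM hi hG ia ib cG hGz wG wR; have [oki ci] := ok i hi.
have [|z zG zd|s' [ok' sl lo dE cE]] := detour hk hl oki _ hG ia ib cG.
- exact: leq_trans hM ci.
- by case: (hGz z zG) => // /freeP/(_ i hi); rewrite zd.
exists s'; split; split=> //.
- by move=> z zd; rewrite dE inE zd.
- move=> z; rewrite dE inE => /orP[|zG]; first by left.
  by case: (hGz z zG) => [/inner_dom|]; [left|right].
- rewrite dE; apply/andP; split; last by have := card_setU_le (dom (st i)) G; lia.
  apply: proper_card; rewrite properE subsetUl /=; apply/subsetPn; exists w.
    by rewrite inE wG orbT.
  by move/freeP/(_ i hi): wR.
Qed.

Lemma inner_card s : #|core s| <= #|[set v | inner s v]| + 2.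
Proof.
have : #|core s| <= #|[set v | inner s v] :|: [set tip s; root s]|.
  apply: subset_leq_card; apply/subsetP=> z zD; rewrite !inE /inner zD /=.
  by case: eqP => //=; case: eqP.
have := card_setU_le [set v | inner s v] [set tip s; root s].
by rewrite cards2; case: (_ != _) => /=; lia.
Qed.

(** The summands pay for hosting a colour class, for tip and root, for one bad vertex per subset of
    an [sg]-set, and for a detour. *)
Let M0 := #|V| + 2 + 2 ^ sg + 4 * k.

Lemma pick2 (A : {set T}) v : 2 <= #|A| -> exists2 u, u \in A & u != v.
Proof.
move=> h; have : 0 < #|A :\ v| by have := cardsD1 v A; case: (_ \in _); lia.
by case/card_gt0P=> u; rewrite !inE => /andP[]; exists u.
Qed.

Lemma attach_edge s v e : inner s v -> (forall z, z \in e -> z \notin dom s) ->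
  #|e| = k.-1 -> red (v |: e) -> red_edge k red (v |: e).
Proof.
move=> iv he ce re; split=> //; rewrite cardsU1 ce.
have -> : v \notin e by apply/negP=> /he; rewrite inner_dom.
by rewrite /=; lia.
Qed.

(** Call a $(k-1)$-set of the rest rich if it forms red edges with two inner vertices of one strand.
    By definition of [tau], either two rich sets meet in exactly one vertex and yield a path of two
    edges to absorb, or some [sg] vertices contain no rich set. Then few inner vertices are bad, and
    a red edge from the others to these [sg] vertices has two inner vertices of one strand. *)
Lemma move st M : config st M -> M0 <= M -> #|rest st| + 6 * k + 2 <= n ->
  ta < #|rest st| -> exists i s', i < r /\ extends st i s'.
Proof.
move=> cf hM hn' hta; have [ok pk] := cf.
have hM4 : 4 * k <= M by move: hM; rewrite /M0; lia.
pose wit i e := [set v | inner (st i) v && red (v |: e)].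
pose F e := [exists i : 'I_r, 2 <= #|wit i e|].
have Rdom i z : i < r -> z \in rest st -> z \notin dom (st i) by move=> hi /freeP; apply.
have hk1 : 0 < k.-1 by move: hk; clear; lia.
have [[Y [sY cY hY]]|[e [f [w [se sf [ce cf'] [Fe Ff] [mef [we wf]]]]]]] :=
    @tau_set T (rest st) F k.-1 sg hk1 (sigma_gt0 hk hH hV) hta; last first.
  move/existsP: Fe => [i wi]; move/existsP: Ff => [j wj].
  have /card_gt0P[v] : 0 < #|wit i e| by apply: ltn_trans wi.
  (* Two witnesses for [f] allow [u] to differ from [v], so that the two edges meet only in [w]. *)
  have [u + uv] := pick2 v wj; rewrite !inE => /andP[iu ru] /andP[iv rv].
  have hi := ltn_ord i; have hj := ltn_ord j.
  have ve := attach_edge iv (fun z ze => Rdom i z hi (se z ze)) ce rv.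
  have uf := attach_edge iu (fun z zf => Rdom j z hj (sf z zf)) cf' ru.
  have nR p z : p < r -> inner (st p) z -> z \notin rest st.
    by move=> hp iz; apply/negP=> /(Rdom p z hp); rewrite (inner_dom iz).
  have vR := nR i v hi iv; have uR := nR j u hj iu.
  have hQ : rpath k red v u ((v |: e) :|: (u |: f)).
    apply: (@rpath_cat _ _ _ v w u).
    - apply: rpath_edge ve _ _ _; rewrite ?inE ?eqxx ?we ?orbT //.
      by apply/eqP=> vw; rewrite vw se in vR.
    - apply: rpath_edge uf _ _ _; rewrite ?inE ?eqxx ?wf ?orbT //.
      by apply/eqP=> wu; rewrite -wu sf in uR.
    - move=> z; rewrite !inE => /orP[/eqP->|ze] /orP[/eqP zu|zf]; last exact: mef.
      + by rewrite zu eqxx in uv.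
      + by rewrite sf in vR.
      + by rewrite -zu se in uR.
  have cQ : #|(v |: e) :|: (u |: f)| <= 2 * k.
    have := card_setU_le (v |: e) (u |: f); have [-> _] := ve; have [-> _] := uf.
    by clear; lia.
  case: (i =P j :> nat) => [ij|/eqP ij].
    exists i; rewrite -ij in iu.
    have [|||s' hs'] := absorb cf hM4 hi hQ iv iu cQ _ (w := w).
    - move=> z; rewrite in_setU !in_setU1.
      by move=> /orP[/orP[/eqP->|/se]|/orP[/eqP->|/sf]]; [left|right|left|right].
    - by rewrite !inE we orbT.
    - exact: se.
    - by exists s'.
  case: (not_linked cf hM4 hn' hi hj ij hQ iv iu cQ) => p z hp.
  have own q x : q < r -> inner (st q) x -> x \in dom (st p) -> inner (st p) x.
    move=> hq iq xp; suff -> : p = q by [].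
    apply/eqP/negPn/negP; rewrite eq_sym => qp.
    by have := pk q p x hq hp qp (inner_dom iq); rewrite xp.
  rewrite in_setU !in_setU1.
  move=> /orP[/orP[/eqP->|/se zR]|/orP[/eqP->|/sf zR]] zd.
  - exact: (own i v hi iv zd).
  - by move: (Rdom p z hp zR); rewrite zd.
  - exact: (own j u hj iu zd).
  - by move: (Rdom p z hp zR); rewrite zd.
(* As no subset of [Y] is rich, each accounts for at most one bad inner vertex per strand. *)
pose bad v := [exists e : {set T}, [&& e \subset Y, #|e| == k.-1 & red (v |: e)]].
pose U i := [set v | inner (st i) v && ~~ bad v].
have cU i : i < r -> #|V| <= #|U i|.
  move=> hi; have [_ hc] := ok i hi.
  pose G e := if (e \subset Y) && (#|e| == k.-1) then wit i e else set0.
  have h1 : #|[set v | inner (st i) v]| <= #|U i :|: \bigcup_(e in powerset Y) G e|.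
    apply: subset_leq_card; apply/subsetP=> v; rewrite !inE => iv; rewrite iv /=.
    case: (boolP (bad v)) => //= /existsP[e /and3P[eY ce re]].
    by apply/bigcupP; exists e; rewrite ?inE // /G eY ce inE iv.
  have h2 : #|\bigcup_(e in powerset Y) G e| <= 2 ^ sg.
    apply: leq_trans (card_bigcup_le _ _) _.
    rewrite cY -card_powerset -sum1_card; apply: leq_sum => e _.
    rewrite /G; case: ifP => [/andP[eY /eqP ce]|_]; last by rewrite cards0.
    have := hY e (subsetP eY) ce; rewrite negb_exists => /forallP/(_ (Ordinal hi)).
    by rewrite -leqNgt.
  have := card_setU_le (U i) (\bigcup_(e in powerset Y) G e); have := inner_card (st i).
  by move: h1 h2 hM hc; rewrite /M0; clear; lia.
have [||g [i [a [b [hi rg [ag aU] [bg bY] gUY]]]]] :=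
    cross_core cf hM4 hn' sY _ (U := U) _ cU.
- by rewrite cY.
- by move=> i z _; rewrite inE => /andP[].
exists i; move: (aU); rewrite inE => /andP[ia nb].
have cg : #|g| <= 2 * k by have [-> _] := rg; rewrite leq_pmull.
have gz z : z \in g -> inner (st i) z \/ z \in rest st.
  by move/gUY; rewrite inE => -[/andP[]|/sY]; [left|right].
case: (boolP [exists c in g, (c != a) && (c \in U i)]) => [/existsP[c /and3P[cg' ca]]|].
  rewrite inE => /andP[ic _].
  have hQ : rpath k red a c g by apply: rpath_edge; rewrite // eq_sym.
  by have [s' hs'] := absorb cf hM4 hi hQ ia ic cg gz bg (sY _ bY); exists s'.
rewrite negb_exists => /forallP no; case/negP: nb; apply/existsP; exists (g :\ a).
have [ck rk] := rg; apply/and3P; split.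
- apply/subsetP=> z; rewrite !inE => /andP[za zg]; have := no z; rewrite zg za /=.
  by case: (gUY z zg) => // ->.
- by have := cardsD1 a g; rewrite ag ck add1n => ->.
- by rewrite setD1K.
Qed.

(** * Iterated moves and the reduction of the rest *)

Lemma rest_update st i s' z : i < r ->
  {subset dom (st i) <= dom s'} -> z \in rest (update st i s') ->
  z \in rest st /\ z \notin dom s'.
Proof.
move=> hi sub /freeP h; have := h i hi; rewrite /update eqxx => zs'; split=> //.
apply/freeP=> j hj; have := h j hj; rewrite /update; case: eqP => // -> _.
by apply: contra zs' => /sub.
Qed.

Lemma config_update st M M' i s' : config st M -> i < r -> strand_ok s' ->
  M' <= #|core s'| -> M' <= M ->
  (forall z, z \in dom s' -> z \in dom (st i) \/ z \in rest st) ->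
  config (update st i s') M'.
Proof.
move=> [ok pk] hi ok' cs' hM hd; split.
  move=> j hj; rewrite /update; case: eqP => // _; have [okj cj] := ok j hj.
  by split=> //; apply: leq_trans cj.
have key j z : j < r -> j != i -> z \in dom s' -> z \notin dom (st j).
  move=> hj ji /hd[zi|/freeP]; last by apply.
  by apply: pk zi; rewrite // eq_sym.
move=> a b z ha hb ab; rewrite /update; case: (a =P i) => [ai|/eqP ai].
  have bi : b != i by rewrite eq_sym -ai.
  by rewrite (negbTE bi); apply: key.
case: (b =P i) => [bi|_]; last exact: pk.
by move=> za; apply/negP=> zs; case/negP: (key a z ha ai zs).
Qed.

Lemma rest_card st M M' i s' : config st M -> config (update st i s') M' -> i < r ->
  #|rest (update st i s')| + #|dom s'| = #|rest st| + #|dom (st i)|.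
Proof.
move=> [_ pk] [_ pk'] hi; have h := card_free pk; have h' := card_free pk'.
have e : \sum_(j < r) #|dom (st j)| =
    #|dom (st i)| + \sum_(j < r | j != Ordinal hi) #|dom (st j)|.
  by rewrite (bigD1 (Ordinal hi)).
have e' : \sum_(j < r) #|dom (update st i s' j)| =
    #|dom s'| + \sum_(j < r | j != Ordinal hi) #|dom (st j)|.
  rewrite (bigD1 (Ordinal hi)) //= {1}/update eqxx; congr (_ + _); apply: eq_bigr => j ji.
  by rewrite /update; case: eqP => // ij; case/eqP: ji; apply: val_inj.
by move: h h'; rewrite e e' -!/(rest _); clear; lia.
Qed.

(** A move costs a core at most $3k$ vertices and the rest at most $2k$, so the rest exceeds [ta] as
    long as moves remain to be made. *)
Lemma many_moves t st M : config st M -> closed st -> M0 + 3 * k * t <= M ->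
  #|rest st| + 6 * k + 2 <= n -> ta + 2 * k * t <= #|rest st| -> exists st',
  [/\ config st' (M - 3 * k * t), closed st',
     forall i, i < r -> slots (st' i) = slots (st i) /\ {subset dom (st i) <= dom (st' i)},
     (forall i z, i < r -> z \in dom (st' i) -> z \in dom (st i) \/ z \in rest st) &
     #|rest st'| + t <= #|rest st|].
Proof.
elim: t st M => [|t IH] st M cf cl hM hn' hta.
  by exists st; split; rewrite ?muln0 ?subn0 ?addn0 //; [move=> i; split | move=> i z; left].
have [||i [s' [hi [[ok' sl lo cE] [sub hd /andP[d1 d2]]]]]] := move cf _ hn'.
- by apply: leq_trans hM; apply: leq_addr.
- apply: leq_trans hta; rewrite -[X in X < _]addn0 ltn_add2l !muln_gt0.
  by move: hk; clear; lia.
have [ok pk] := cf; have [_ ci] := ok i hi.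
have cf' : config (update st i s') (M - 3 * k).
  by apply: (config_update cf) => //; [move: ci cE; clear | clear]; lia.
have rc := rest_card cf cf' hi.
have [||||st' [c1 c2 c3 c4 c5]] := IH _ _ cf'.
- move=> j hj; rewrite /update; case: eqP => [_|_]; last exact: cl.
  by apply: lo; apply: cl.
- by move: hM; rewrite mulnS; clear; lia.
- by move: rc d1 hn'; clear; lia.
- by move: rc d2 hta; rewrite mulnS; clear; lia.
exists st'; split=> //.
- by move: c1; rewrite mulnS -subnDA.
- move=> j hj; have [e1 e2] := c3 j hj; move: e1 e2; rewrite /update; case: eqP => [->|_] // -> e2.
  by split=> // z /sub/e2.
- move=> j z hj /(c4 j z hj)[|/(rest_update hi sub)[zr _]]; last by right.
  by rewrite /update; case: eqP => [->|_] //; [apply: hd | left].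
- by move: rc d1 c5; clear; lia.
Qed.

(** By the pigeonhole principle, after [t0] moves some strand has gained at least $k-1$ vertices. *)
Let t0 := r * (k - 2) + 1.
Let rho := ta + 2 * k * t0.
Hypothesis hlM : M0 + 3 * k * t0 <= l.

(* After enough moves some strand has gained [k - 1] vertices; rotating it to a fresh slot
   gives back at most [k - 2] of them. *)
Lemma gain st M : config st M -> M0 + 3 * k * t0 <= M <= l -> closed st ->
  #|rest st| + 6 * k + 2 <= n -> rho <= #|rest st| ->
  (forall i, i < r -> 0 < slots (st i)) -> exists i s',
  [/\ i < r, config (update st i s') M, closed (update st i s'), slots s' = (slots (st i)).-1 &
    #|rest (update st i s')| < #|rest st|].
Proof.
move=> cf /andP[hM hMl] cl hn' hrho hsl.
have [st' [[ok' pk'] cl' hs' hd hr]] := many_moves cf cl hM hn' hrho.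
have [ok pk] := cf.
have [j hj gj] : exists2 j, j < r & #|dom (st j)| + k.-1 <= #|dom (st' j)|.
  apply: NNPP => no.
  have : \sum_(i < r) #|dom (st' i)| <= \sum_(i < r) (#|dom (st i)| + (k - 2)).
    apply: leq_sum => i _; rewrite leqNgt; apply/negP=> h; apply: no; exists i => //.
    by move: h hk; clear; lia.
  rewrite big_split /= sum_nat_const card_ord.
  have := card_free pk; have := card_free pk'; rewrite -!/(rest _).
  move: hr; rewrite /t0; clear.
  by move: (r * _) (\sum_(i < r) _) (\sum_(i < r) _) #|T| => p1 p2 p3 p4; lia.
have [okj cj] := ok' j hj; have [slj subj] := hs' j hj.
have sl : slots (st' j) = (slots (st j)).-1.+1.
  by rewrite slj prednK // hsl.
have [|s' [[oks los sls cs] [sub dc]]] := rotate hk hl okj (cl' j hj) sl.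
  by move: cj hM; rewrite /M0; clear; lia.
have hds z : z \in dom s' -> z \in dom (st j) \/ z \in rest st by move/sub/hd; apply.
have cfu : config (update st j s') M by apply: (config_update cf); rewrite // cs.
(* Only strand [j] is replaced; the moves of the other strands are undone, so their cores do not
   shrink. *)
exists j, s'; split=> //.
  by move=> i hi; rewrite /update; case: eqP => // _; apply: cl.
by have := rest_card cf cfu hj; move: gj dc hk; clear; lia.
Qed.

(** Each use of [gain] spends one slot and lowers the rest by at least one vertex, so as many slots
    as vertices in the rest suffice. *)
Lemma shrink_rest x st M : #|rest st| <= x -> config st M -> M0 + 3 * k * t0 <= M <= l ->
  closed st -> #|rest st| + 6 * k + 2 <= n -> (forall i, i < r -> x <= slots (st i)) ->
  exists st', [/\ config st' M, closed st', #|rest st'| <= rho & #|rest st'| <= #|rest st|].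
Proof.
elim: x st => [|x IH] st hx cf hM cl hn' hsl.
  by exists st; split=> //; apply: leq_trans hx _.
case: (leqP #|rest st| rho) => hrho; first by exists st.
have [|i [s' [hi cf' cl' sl hr]]] := gain cf hM cl hn' (ltnW hrho).
  by move=> i hi; apply: leq_trans (hsl i hi).
have [|||st' [c1 c2 c3 c4]] := IH _ _ cf' hM cl'.
- by move: hr hx; clear; lia.
- by move: hr hn'; clear; lia.
- move=> j hj; rewrite /update; case: eqP => [ji|_]; last exact: leq_trans (hsl j hj).
  by rewrite sl; have := hsl i hi; clear; lia.
by exists st'; split=> //; move: c4 hr; clear; lia.
Qed.

(** The whole rest takes the place of the set [Y] of [move], so a red edge with $k-1$ vertices in
    the rest is no longer excluded. *)
Lemma end_move st M : config st M -> M0 <= M -> #|rest st| + 6 * k + 2 <= n ->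
  sg <= #|rest st| -> exists i, i < r /\ ((exists s', extends st i s') \/
   exists v e, [/\ inner (st i) v, red_edge k red (v |: e), {subset e <= rest st} & #|e| = k.-1]).
Proof.
move=> cf hM hn' hsg; have [ok pk] := cf.
have hM4 : 4 * k <= M by move: hM; rewrite /M0; clear; lia.
have [|||g [i [a [b [hi rg [ag aU] [bg bY] gUY]]]]] :=
    cross_core cf hM4 hn' (X := rest st) (U := fun i => [set v | inner (st i) v]) _ hsg.
- by [].
- by move=> i z _; rewrite inE.
- move=> i hi; have [_ hc] := ok i hi; have := inner_card (st i).
  by move: hc hM; rewrite /M0; clear; lia.
exists i; split=> //; rewrite inE in aU.
have gz z : z \in g -> inner (st i) z \/ z \in rest st.
  by move/gUY; rewrite inE.
have cg : #|g| <= 2 * k by have [-> _] := rg; rewrite leq_pmull.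
case: (boolP [exists c in g, (c != a) && inner (st i) c]) => [/existsP[c /and3P[cg' ca ic]]|].
  have hQ : rpath k red a c g by apply: rpath_edge; rewrite // eq_sym.
  by left; apply: (absorb cf hM4 hi hQ aU ic cg gz bg).
rewrite negb_exists => /forallP no; right; exists a, (g :\ a); split=> //.
- by rewrite setD1K.
- move=> z; rewrite in_setD1 => /andP[za zg]; have := no z; rewrite zg za /=.
  by case: (gz z zg) => // ->.
- by have [ck _] := rg; have := cardsD1 a g; rewrite ag ck add1n => ->.
Qed.

(** The rest always has at least [m] vertices, hence some, yet each step makes it smaller. The
    disjunction records whether a first end has been attached, which takes $k-1$ vertices from a
    rest of at most [ta]. *)
Lemma finish x st M : #|rest st| <= x -> config st M -> M0 + 3 * k * x <= M ->
  #|rest st| + 6 * k + 2 <= n ->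
  (closed st \/ exists2 i0, forall i, i < r -> i != i0 -> looped (st i) &
     #|rest st| + k.-1 <= ta) -> False.
Proof.
elim: x st M => [|x IH] st M hx cf hM hn' hst.
  have : m <= #|rest st| by apply: m_le_rest cf _; move: hM hk; rewrite /M0; clear; lia.
  have := sigma_gt0 hk hH hV; move: hx; rewrite /m -/sg; clear; lia.
have hM1 : M0 <= M by apply: leq_trans hM; apply: leq_addr.
have hmr : m <= #|rest st| by apply: m_le_rest cf _; move: hM1 hk; rewrite /M0; clear; lia.
have [ok pk] := cf.
have step i s' : i < r -> extends st i s' ->
    [/\ config (update st i s') (M - 3 * k), #|rest (update st i s')| < #|rest st| &
      forall j, looped (st j) -> looped (update st i s' j)].
  move=> hi [[ok' _ lo cE] [_ hd /andP[d1 _]]]; have [_ ci] := ok i hi.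
  have cf' : config (update st i s') (M - 3 * k).
    by apply: (config_update cf) => //; [move: ci cE; clear | clear]; lia.
  split=> //; first by have := rest_card cf cf' hi; move: d1; clear; lia.
  by move=> j; rewrite /update; case: eqP => // ->.
have hM2 : M0 + 3 * k * x <= M - 3 * k by move: hM; rewrite mulnS; clear; lia.
have recur i s' : i < r -> extends st i s' -> False.
  move=> hi hs'; have [cf' hr lo] := step i s' hi hs'.
  apply: (IH _ _ _ cf' hM2); [by move: hr hx; clear; lia|by move: hr hn'; clear; lia|].
  case: hst => [cl|[i0 lo' hta]]; [left|right].
    by move=> j hj; apply/lo/cl.
  exists i0; last by move: hr hta; clear; lia.
  by move=> j hj ji; apply/lo/lo'.
case: (classic (closed st /\ ta < #|rest st|)) => [[cl hta]|nta].
  by have [i [s' [hi hs']]] := move cf hM1 hn' hta; apply: recur hs'.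
have hsg : sg <= #|rest st| by apply: leq_trans hmr; apply: leq_maxr.
have [i [hi [[s' hs']|[v [e [iv re se ce]]]]]] := end_move cf hM1 hn' hsg.
  exact: recur hs'.
have [oki ci] := ok i hi.
have e0 : e != set0 by rewrite -card_gt0 ce; move: hk; clear; lia.
have dis z : z \in e -> z \notin dom (st i) by move/se/freeP; apply.
case: hst => [cl|[i0 lo hta]].
  have hta : #|rest st| <= ta by rewrite leqNgt; apply/negP=> h; apply: nta.
  have [|s' [ok' dE cE]] := attach hk oki (cl i hi) _ iv re e0 dis.
    by move: ci hM1; rewrite /M0; clear; lia.
  have cf' : config (update st i s') (M - 3 * k).
    apply: (config_update cf) => //; [by move: ci cE; clear; lia|by clear; lia|].
    by move=> z; rewrite dE inE => /orP[|/se]; [left|right].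
  have hr := rest_card cf cf' hi.
  have dc : #|dom s'| = #|dom (st i)| + k.-1.
    rewrite dE cardsU ce; suff -> : dom (st i) :&: e = set0 by rewrite cards0 subn0.
    by apply/setP=> z; rewrite in_setI in_set0; apply/negbTE/negP=> /andP[zd /dis]; rewrite zd.
  apply: (IH _ _ _ cf' hM2).
  - by move: hr dc hx hk; clear; lia.
  - by move: hr dc hn'; clear; lia.
  - right; exists i; last by move: hr dc hta; clear; lia.
    by move=> j hj ji; rewrite /update (negbTE ji); apply: cl.
(* With a second end the strand is still spanned, but the rest drops to at most $ta-2(k-1)$, which
   is below [m]. *)
have hsp : spanned k red (dom (st i) :|: e).
  by apply: (attach_spanned hk hl oki _ iv re e0 dis); move: ci hM1 hk; rewrite /M0; clear; lia.
pose W := update (fun j => dom (st j)) i (dom (st i) :|: e).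
have : m <= #|free r W|.
  apply: m_le_free => j hj; rewrite /W /update; case: eqP => _; first exact: spanned_lt.
  by apply: dom_lt cf _ hj; move: hM1 hk; rewrite /M0; clear; lia.
have hW : #|free r W :|: e| <= #|rest st|.
  apply: subset_leq_card; apply/subsetP=> z; rewrite in_setU => /orP[/freeP h|/se//].
  apply/freeP=> j hj; have := h j hj; rewrite /W /update; case: eqP => // ->.
  by rewrite in_setU negb_or => /andP[].
have dW : free r W :&: e = set0.
  apply/setP=> z; rewrite in_setI in_set0; apply/negbTE/negP=> /andP[/freeP/(_ i hi)].
  by rewrite /W /update eqxx in_setU negb_or => /andP[_ /negP].
move: hW; rewrite cardsU dW cards0 ce; move: hta hk; rewrite /m; clear; lia.
Qed.

(** * Greedy choice of the strands *)

Variables (L R : nat).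
Let B := L + 2 * k * r.
(** Room in each core for a slot and two links, for hosting a colour class, and for discarding one
    edge per pair of sets. *)
Hypothesis hL : l + 4 * k + #|V| + 2 + r.+1 * r.+1 * k <= L.
Hypothesis hR : forall Y, R <= #|Y| ->
  exists D : {set T}, [/\ {subset D <= Y}, clique k red D & #|D| = B + k].
Hypothesis hRn : R < n.

Definition avail st i : {set T} := ~: \bigcup_(j < i) dom (st j).

Lemma availP st i z : reflect (forall j, j < i -> z \notin dom (st j)) (z \in avail st i).
Proof. exact: freeP. Qed.

(* Later strands get larger cores, so that an earlier strand can be moved onto them. *)
Definition good i s : Prop :=
  [/\ strand_ok s, looped s, #|core s| = L + 2 * k * i &
      #|body s| <= (l + 3 * k) * (slots s).+1].

Definition greedy st q : Prop := forall i, i < q ->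
  [/\ good i (st i), {subset dom (st i) <= avail st i} &
   forall s, good i s -> {subset dom s <= avail st i} -> slots s <= slots (st i)].

Lemma good_lt i s : good i s -> #|dom s| < n.
Proof.
move=> [ok _ cs _]; apply: spanned_lt; apply: (strand_spanned hk hl ok).
by rewrite cs; move: hL hk; clear; lia.
Qed.

(** The earlier strands have fewer than [n] vertices each, so more than [R] are available and
    contain a red clique to start from; slots are bounded in number by [slotted_card]. *)
Lemma greedy_ex q : q <= r -> exists st, greedy st q.
Proof.
elim: q => [|q IH] hq.
  have [x0 _] : exists x0 : T, x0 \in setT.
    have /card_gt0P[x0 _] : 0 < #|T|; last by exists x0.
    have := sigma_gt0 hk hH hV; rewrite hT /m -/sg; move: (r * _); clear; lia.
  by exists (fun _ => Strand 0 x0 x0 set0 set0).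
have [st gst] := IH (ltnW hq).
have hav : R <= #|avail st q|.
  have h : #|\bigcup_(j < q) dom (st j)| <= q * n.-1.
    apply: leq_trans (card_bigcup_le _ _) _.
    rewrite -[q in q * _](card_ord q) -sum_nat_const; apply: leq_sum => j _.
    by have [gj _ _] := gst j (ltn_ord j); have := good_lt gj; clear; lia.
  have h2 : q.+1 * n.-1 <= r * n.-1 by rewrite leq_mul2r hq orbT.
  have := cardsC (\bigcup_(j < q) dom (st j)); rewrite -/(avail st q) hT.
  have hm : 0 < m by have := sigma_gt0 hk hH hV; rewrite /m -/sg; clear; lia.
  move: h h2 hm hRn; rewrite mulSn.
  by move: (q * _) (r * _) => a b; clear; lia.
pose P p := exists s, [/\ good q s, {subset dom s <= avail st q} & slots s = p].
have [||p [[s [gs ss sp]] hmax]] := @bounded_max P #|T|.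
- have [D [sD cD hD]] := hR hav.
  have [||s [[ok lo cs bs sl] sub]] := start_strand hk l cD (m := L + 2 * k * q).
  + rewrite hD /B leq_add2r leq_add2l leq_mul2l (ltnW hq) orbT //.
  + by move: hL; clear; lia.
  exists s; split=> //; last by move=> z /sub/sD.
  by split; rewrite ?bs ?sl ?muln1 //; clear; lia.
- move=> p [s [[[hS _ _ _ _] _ _ _] _ <-]].
  exact: leq_trans (slotted_card hS) (max_card _).
exists (update st q s) => i; rewrite ltnS leq_eqVlt => hi.
have av j : j <= q -> avail (update st q s) j = avail st j.
  move=> jq; congr (~: _); apply: eq_bigr => j' _; rewrite /update.
  by case: eqP => // e; have := ltn_ord j'; rewrite e ltnNge jq.
case/orP: hi => [/eqP->|hi].
  rewrite av // /update eqxx; split=> // s' gs' sub; rewrite leqNgt sp.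
  by apply/negP=> /hmax; apply; exists s'.
rewrite av; last exact: ltnW.
by rewrite /update; case: eqP => [e|_]; [rewrite e ltnn in hi | apply: gst].
Qed.

Lemma greedy_packed st : greedy st r -> packed r (fun i => dom (st i)).
Proof.
move=> gst i j z hi hj; case: ltngtP => // ij _ zi; apply/negP=> zj.
  by have [_ /(_ z zj)/availP/(_ i ij)/negP] := gst j hj.
by have [_ /(_ z zi)/availP/(_ j ij)/negP] := gst i hi.
Qed.

(** A large rest contains a red clique [D]. Two disjoint links from a strand to the core of a later
    one, or to [D], let [lengthen] add a slot, against maximality. *)
Lemma greedy_rest st : greedy st r -> #|rest st| < R.
Proof.
move=> gst; have pk := greedy_packed gst; rewrite ltnNge; apply/negP=> /hR[D [sD cD hD]].
pose U i := if i < r then [set v | inner (st i) v] else D.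
pose tgt i := if i < r then core (st i) else D.
have Ut i z : z \in U i -> z \in tgt i.
  by rewrite /U /tgt; case: ifP => // _; rewrite inE => /andP[].
have tgtdom i j z : i < r -> j <= r -> i < j -> z \in tgt j -> z \notin dom (st i).
  move=> hi hj ij; rewrite /tgt; case: ifP => [hj'|_] zj; last by have /freeP := sD z zj; apply.
  by apply: pk (_ : z \in dom (st j)); rewrite // ?inE ?zj ?orbT // neq_ltn ij orbT.
pose lk (p : 'I_r.+1 * 'I_r.+1) g := [&& #|g| == k, red g, [exists a in g, a \in U p.1],
  [exists b in g, b \in U p.2] & [forall z in g, [exists i : 'I_r.+1, (p.1 <= i) && (z \in U i)]]].
(* One link is reserved for each pair of sets that has any. A link found off all reserved edges then
   has a disjoint reserved partner for the same pair. *)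
pose g0 p := odflt set0 [pick g | lk p g].
pose Z := \bigcup_(p : 'I_r.+1 * 'I_r.+1) g0 p.
have cZ : #|Z| <= r.+1 * r.+1 * k.
  apply: leq_trans (card_bigcup_le _ _) _.
  apply: (@leq_trans (\sum_(p : 'I_r.+1 * 'I_r.+1) k)).
    apply: leq_sum => p _; rewrite /g0; case: pickP => [g /and5P[/eqP-> _ _ _ _]|_] //=.
    by rewrite cards0.
  by rewrite sum_nat_const card_prod !card_ord.
have dUW i : #|U i| <= #|U i :\: Z| + r.+1 * r.+1 * k.
  by apply: leq_trans (card_setD_ge _ Z) _; rewrite leq_add2l.
have [|||//|[g [i [j [a [b [/andP[ij jr] rg [ag aW] [bg bW] gW]]]]]]] :=
    @crossing_edge k V H hk hH hV T red (fun i => U i :\: Z).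
- move=> i j z /andP[ij jr]; have hi := leq_trans ij jr.
  rewrite !in_setD => /andP[_ zi]; rewrite negb_and; apply/orP; right; apply/negP=> /Ut.
  move=> /(tgtdom i j z hi jr ij); rewrite inner_dom //.
  by move: zi; rewrite /U hi inE.
- move=> i hi; have := dUW i; rewrite {1}/U hi.
  have [[_ _ cs _] _ _] := gst i hi; have := inner_card (st i); rewrite cs.
  by move: hL; clear; lia.
- have := dUW r; rewrite {1}/U ltnn hD /B.
  by have := sigma_le H; rewrite -/sg -/r; move: hL; clear; lia.
have hi : i < r := leq_trans ij jr.
have hir : i < r.+1 := ltnW hi.
pose p := (Ordinal hir, Ordinal (jr : j < r.+1)).
have lkg : lk p g.
  have [cg reg] := rg; apply/and5P; split=> //; first exact/eqP.
  - by apply/existsP; exists a; rewrite ag; move: aW; rewrite in_setD => /andP[].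
  - by apply/existsP; exists b; rewrite bg; move: bW; rewrite in_setD => /andP[].
  - apply/forallP=> z; apply/implyP=> /gW[x /andP[ix xr]]; rewrite in_setD => /andP[_ zx].
    by apply/existsP; exists (Ordinal (xr : x < r.+1)); rewrite ix.
have [g' lkg' g'Z] : exists2 g', lk p g' & {subset g' <= Z}.
  have hg0 : lk p (g0 p) by rewrite /g0; case: pickP => [//|/(_ g)]; rewrite lkg.
  by exists (g0 p) => // z zg; apply/bigcupP; exists p.
have gg' z : z \in g' -> z \notin g.
  by move/g'Z=> zZ; apply/negP=> /gW[x _]; rewrite in_setD zZ.
have [gi si mi] := gst i hi; have [oki loi ci bi] := gi.
have lkP f : lk p f -> (exists d x, fresh_link k red (st i) (tgt j) f d x) /\
    forall z, z \in f -> exists x, [/\ i <= x, x <= r & z \in U x].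
  case/and5P=> /eqP cf rf /existsP[d /andP[df]] /= dU /existsP[x /andP[xf]] /= xU /forallP h.
  have hz z : z \in f -> exists x, [/\ i <= x, x <= r & z \in U x].
    move=> zf; have := h z; rewrite zf => /existsP[y /andP[iy zy]].
    by exists y; split=> //; rewrite -ltnS.
  split=> //; exists d, x; split; first split=> //.
  - by move: dU; rewrite /U hi inE.
  - exact: Ut.
  - move=> z /hz[y [iy yr zy]] zd; move: iy; rewrite leq_eqVlt => /orP[/eqP iy|iy].
      by move: zy; rewrite -iy /U hi inE.
    by have := tgtdom i y z hi yr iy (Ut _ _ zy); rewrite zd.
have [[d [x fl]] hz] := lkP g lkg; have [[d' [x' fl']] hz'] := lkP g' lkg'.
have hci : l + 4 * k <= #|core (st i)| by rewrite ci; move: hL; clear; lia.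
have ctj : clique k red (tgt j).
  rewrite /tgt; case: ifP => // hj; have [[[_ cl _ _ _] _ _ _] _ _] := gst j hj.
  exact: cl.
(* The target exceeds the core size prescribed for strand [i] by $2k$, the room that two links take
   up. *)
have htj : L + 2 * k * i + 2 * k <= #|tgt j|.
  apply: (@leq_trans (L + 2 * k * j)).
    by rewrite -addnA leq_add2l -mulnSr leq_mul2l ij orbT.
  rewrite /tgt; case: ifP => hj; first by have [[_ _ -> _] _ _] := gst j hj.
  have -> : j = r by apply/eqP; rewrite eqn_leq (jr : j <= r) leqNgt hj.
  by rewrite hD leq_addr.
have avi z x1 : i <= x1 -> x1 <= r -> z \in tgt x1 -> z \in avail st i.
  move=> ix xr zx; apply/availP=> y yi; apply: (tgtdom y x1) zx => //.
    exact: ltn_trans yi hi.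
  exact: leq_trans yi ix.
have [||s [[oks los cs bs sls] sub]] := lengthen hk hl oki loi hci ctj htj _ _ gg' fl' fl.
- by move: hL; clear; lia.
- by move=> z; apply: tgtdom.
have : slots s <= slots (st i).
  apply: mi.
    split=> //; rewrite sls mulnS; apply: leq_trans bs _.
    by rewrite -addnA addnC leq_add2l.
  move=> z /sub; rewrite in_setU => /orP[/si//|]; rewrite !in_setU => /orP[/orP[]|].
  - by move/hz'=> [y [iy yr /Ut]]; apply: avi.
  - by move/hz=> [y [iy yr /Ut]]; apply: avi.
  - exact: avi (ltnW ij) jr.
by rewrite sls ltnn.
Qed.

Hypothesis hlarge : (l + 3 * k) * R.+1 + B + R + 6 * k + 2 <= n.
Hypothesis hlrho : M0 + 3 * k * rho <= l.

(** A strand with fewer than [R] slots would be short and leave too many vertices in the rest; so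
    the slots suffice to reduce the rest to [rho], and [finish] applies. *)
Lemma no_colouring : False.
Proof.
have [st gst] := greedy_ex (leqnn r).
have pk := greedy_packed gst; have hr := greedy_rest gst.
have cf : config st l.
  split=> // i hi; have [[ok _ cs _] _ _] := gst i hi; split=> //.
  by rewrite cs; move: hL; clear; lia.
have cl : closed st by move=> i hi; have [[_ lo _ _] _ _] := gst i hi.
have hsl i : i < r -> R <= slots (st i).
  move=> hi; have [gi _ _] := gst i hi; have [_ _ cs bs] := gi.
  have hd : #|dom (st i)| <= (l + 3 * k) * (slots (st i)).+1 + B.
    apply: leq_trans (card_setU_le _ _) _; apply: leq_add => //.
    by rewrite cs /B leq_add2l leq_mul2l (ltnW hi) orbT.
  have hsum : \sum_(j < r) #|dom (st j)| <= #|dom (st i)| + r.-1 * n.-1.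
    rewrite (bigD1 (Ordinal hi)) //= leq_add2l.
    apply: (@leq_trans (\sum_(j < r | j != Ordinal hi) n.-1)).
      by apply: leq_sum => j _; have [gj _ _] := gst j (ltn_ord j); have := good_lt gj; clear; lia.
    by rewrite sum_nat_const cardC1 card_ord.
  have hT' := card_free pk; rewrite -/(rest st) hT in hT'.
  have hrr : r * n.-1 = r.-1 * n.-1 + n.-1 by rewrite -mulSnr prednK //; apply: leq_ltn_trans hi.
  rewrite leqNgt; apply/negP=> hlt.
  have hmul : (l + 3 * k) * (slots (st i)).+1 <= (l + 3 * k) * R.+1.
    by rewrite leq_mul2l ltnS (ltnW hlt) orbT.
  move: hd hsum hT' hrr hmul hlarge hr.
  move: (r * _) (r.-1 * _) (_ * R.+1) (_ * _.+1) (\sum_(j < r) _) => a b c d e.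
  by clear; lia.
have hn1 : R + 6 * k + 2 <= n.
  by move: hlarge; move: (_ * _) => a; clear; lia.
have hrest : #|rest st| + 6 * k + 2 <= n.
  by apply: leq_trans hn1; rewrite !leq_add2r ltnW.
have [|st' [cf' cl' hr' hr'']] := shrink_rest (ltnW hr) cf _ cl hrest hsl.
  by rewrite hlM leqnn.
apply: (finish hr' cf' hlrho) (or_introl cl').
by apply: leq_trans hrest; rewrite !leq_add2r.
Qed.

End Configurations.

(** * Choice of the constants and conclusion *)

Theorem theorem1p7 (k : nat) (hk : (3 <= k)%N) (V : finType) (H : {set {set V}})
    (hH : uniform k H) (hV : (0 < #|V|)%N) :
  exists n0 : nat, forall n : nat, (n0 <= n)%N -> n = 1 %[mod k.-1] ->
    (ramsey k (loose_path k n) H <=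
      (chi H).-1 * n.-1 + maxn ((tau k.-1 (sigma H) + 3) - 2 * k) (sigma H))%N.
Proof.
pose r := (chi H).-1; pose rr := r.+1 * r.+1 * k.
pose M0 := #|V| + 2 + 2 ^ sigma H + 4 * k.
pose t0 := r * (k - 2) + 1; pose rho := tau k.-1 (sigma H) + 2 * k * t0.
(* The slot size is $1$ modulo $k-1$ and large enough for a core to survive [t0] moves, or later
   [rho] moves; [L], [R] and the bound for [n] follow in this order. *)
pose q0 := M0 + 3 * k * (rho + t0); pose l := q0.+1 * k.-1 + 1.
pose L := l + 4 * k + #|V| + 2 + rr.
have ql : q0 <= l.
  rewrite /l addn1; apply: leqW; apply: leq_trans (leqnSn q0) _; apply: leq_pmulr.
  by move: hk; clear; lia.
have [R hR] := hypergraph_ramsey k (L + 2 * k * r + k) #|V|.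
exists ((l + 3 * k) * R.+1 + (L + 2 * k * r) + R + 6 * k + 2) => n hn0 hmod.
apply: ramsey_le => c _; apply: NNPP => no.
apply: (@no_colouring k V H hk hH hV _ c n _ _ _ _ l q0 _ _ L R _ _ _ _) => //.
- exists (n %/ k.-1); rewrite {1}(divn_eq n k.-1) hmod modn_small //.
  by move: hk; clear; lia.
- by rewrite card_ord.
- move=> a b S hS; rewrite ltnNge; apply/negP=> /(rpath_copy hk hS) hf.
  by apply: no; left.
- by case=> phi hphi; apply: no; right; exists phi.
- apply: leq_trans ql; rewrite leq_add2l leq_mul2l leq_addl orbT //.
- move=> Y hY; have [D [sD [[cD kD]|[cD kD]]]] := hR _ Y c hY; first by exists D.
  case: no; right.
  have [phi phiD] : exists phi : V -> 'I_((chi H).-1 * n.-1 +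
      maxn ((tau k.-1 (sigma H) + 3) - 2 * k) (sigma H)), injective phi /\ forall v, phi v \in D.
    exists (fun v => enum_val (cast_ord (esym cD) (enum_rank v))); split.
      by move=> v w /enum_val_inj/cast_ord_inj/enum_rank_inj.
    by move=> v; apply: enum_valP.
  case: phiD => phi_inj phiD; exists phi; split=> // e eH.
  apply: negbTE; apply: kD; last by rewrite card_imset // hH.
  by apply/subsetP=> z /imsetP[v _ ->].
- by move: hn0; move: (_ * R.+1) => a; clear; lia.
- by apply: leq_trans ql; rewrite leq_add2l leq_mul2l leq_addr orbT.
Qed.
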